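(* Let $(Z_n)_{n\ge0}$ be a linear fractional Galton–Watson process in i.i.d. random environment (as in the context) which is supercritical, i.e. $R_\infty<\infty=R^{(-1)}_\infty$ a.s. Then for almost every realization of $\mathbf{e}$, $W_n:=\Pi_nZ_n$, $n\ge0$, is a nonnegative martingale with mean one under $\mathbf{P}$, hence converges $\mathbf{P}$-a.s. to a random variable $W_\infty$, whose conditional law is $$\mathbf{P}(W_\infty\in\cdot)=\Big(1-\frac{1}{R_\infty}\Big)\delta_0+\frac{1}{R_\infty}\,\mathrm{Exp}\Big(\frac{1}{R_\infty}\Big),$$ and in particular $W_\infty$ also has $\mathbf{P}$-mean one.
   Context: Let $(A_n,B_n)_{n\ge1}$ be i.i.d. copies of $(A,B)$ with $\mathbb{P}(A>0,B>0,A+B\ge1)=1$; $\mathbf{e}=(A_n,B_n)_{n\ge1}$. For $a,b>0$, $a+b\ge1$, $LF(a,b)$ is the distribution on $\mathbb{N}_0$ whose generating function $f$ satisfies $1/(1-f(s))=a/(1-s)+b$, $s\in[0,1)$. $(Z_n)$, $Z_0=1$: given $\mathbf{e}$, each individual of generation $k-1$ independently has offspring law $LF(A_k,B_k)$. $\mathbf{P}=\mathbb{P}(\cdot\mid\mathbf{e})$. $\Pi_0=1$, $\Pi_n=\prod_{k=1}^nA_k$, $R_\infty=\sum_{k\ge1}\Pi_{k-1}B_k$, $R^{(-1)}_\infty=\sum_{k\ge1}\Pi_k^{-1}B_k$. $\mathrm{Exp}(\lambda)$ is the exponential distribution with rate $\lambda$ (mean $1/\lambda$). *)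

(* Defs.v *)
From HB Require Import structures.
From mathcomp Require Import all_boot all_order all_algebra.
From mathcomp Require Import all_classical all_reals all_analysis.
From mathcomp Require Import finmap exponential_distribution.
Set Implicit Arguments.
Unset Strict Implicit.
Unset Printing Implicit Defensive.
Import Order.TTheory GRing.Theory Num.Theory.
Import numFieldNormedType.Exports.
Local Open Scope classical_set_scope.
Local Open Scope ring_scope.

Section Defs.
Context {R : realType}.

Definition mutually_independent {d d'} {Omega : measurableType d}
  {T : measurableType d'} (P : probability Omega R) {I : choiceType}
  (X : I -> Omega -> T) : Prop :=
  forall (J : {fset I}) (V : I -> set T),
    (forall i, i \in J -> measurable (V i)) ->
    P (\bigcap_(i in [set` J]) (X i @^-1` V i)) =
    (\prod_(i <- J) P (X i @^-1` V i))%E.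

(* Same, for nat-valued random variables (nat with its discrete sigma-algebra:
   every subset is measurable). *)
Definition mutually_independent_nat {d} {Omega : measurableType d}
  (P : probability Omega R) {I : choiceType} (X : I -> Omega -> nat) : Prop :=
  forall (J : {fset I}) (V : I -> set nat),
    P (\bigcap_(i in [set` J]) (X i @^-1` V i)) =
    (\prod_(i <- J) P (X i @^-1` V i))%E.

Definition iid {d d'} {Omega : measurableType d} {T : measurableType d'}
  (P : probability Omega R) (X : nat -> Omega -> T) : Prop :=
  [/\ forall n, measurable_fun setT (X n),
      mutually_independent P X &
      forall n (V : set T), measurable V -> P (X n @^-1` V) = P (X 0%N @^-1` V)].

Definition LF_law (a b : R) (p : nat -> R) : Prop :=
  [/\ forall k, 0 <= p k,
      series p @ \oo --> (1 : R) &
      forall s : R, 0 <= s < 1 ->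
        (1 - limn (series (fun k => p k * s ^+ k)))^-1 = a / (1 - s) + b].

(* Pi_n = A_1 ... A_n; the environment is indexed from 0:  a k = A_{k+1}. *)
Definition Pi (a : nat -> R) (n : nat) : R := \prod_(i < n) a i.

Definition R_infty (a b : nat -> R) : \bar R :=
  (\sum_(0 <= k <oo) (Pi a k * b k)%:E)%E.

Definition R_infty_inv (a b : nat -> R) : \bar R :=
  (\sum_(0 <= k <oo) ((Pi a k.+1)^-1 * b k)%:E)%E.

(* (Z_n) is a Galton-Watson process in the (deterministic) environment
   (a,b), realised by offspring variables xi n i (offspring number of the
   i-th individual of generation n), all mutually independent, xi n i having
   law LF(a n, b n) (= LF(A_{n+1}, B_{n+1})). *)
Definition LF_GW_process {d} {Omega : measurableType d}
  (P : probability Omega R) (a b : nat -> R)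
  (xi : nat -> nat -> Omega -> nat) (Z : nat -> Omega -> nat) : Prop :=
  [/\ forall n i k, measurable (xi n i @^-1` [set k]),
      mutually_independent_nat P (fun ni : nat * nat => xi ni.1 ni.2),
      forall n i, LF_law (a n) (b n) (fun k => fine (P (xi n i @^-1` [set k]))),
      forall w, Z 0%N w = 1%N &
      forall n w, Z n.+1 w = (\sum_(i < Z n w) xi n i w)%N].

Definition in_natural_filtration {Omega : Type} (Z : nat -> Omega -> nat)
  (n : nat) (F : set Omega) : Prop :=
  exists S : set (seq nat), F = [set w | S [seq Z k w | k <- iota 0 n.+1]].

Definition martingale {d} {Omega : measurableType d} (P : probability Omega R)
  (Z : nat -> Omega -> nat) (W : nat -> Omega -> R) : Prop :=
  (forall n, measurable_fun setT (W n)) /\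
  (forall n (S : set R), measurable S -> in_natural_filtration Z n (W n @^-1` S)) /\
  (forall n, P.-integrable setT (EFin \o W n)) /\
  (forall n F, in_natural_filtration Z n F ->
     (\int[P]_(w in F) (W n.+1 w)%:E = \int[P]_(w in F) (W n w)%:E)%E).

End Defs.

(* Main.v *)
(* The map s |-> 1 / (1 - f(s)) turns composition of linear fractional
   generating functions into composition of affine maps, so in a fixed
   environment Z_n has law LF(Pi_n, R_n), where R_n is the n-th partial sum of
   R_infty.  Comparing power series, P(Z_n > k) = q^k / (Pi_n + R_n) with
   q = R_n / (Pi_n + R_n), hence
     exp(-x / R_n) / (Pi_n + R_n) <= P(W_n > x)
       <= exp(-(x - Pi_n) / (Pi_n + R_n)) / (Pi_n + R_n).
   R_infty < oo = R_infty^(-1) forces inf_n Pi_n = 0.  Along a subsequence with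
   Pi_n -> 0 both bounds tend to exp(-x / R_infty) / R_infty, and the almost
   sure convergence of the martingale W_n identifies this limit with
   P(W_infty > x).  The martingale converges because, conditionally on the
   past, each further upcrossing of [x, y] has probability at most x / y. *)

Require Import Defs.
From HB Require Import structures.
From mathcomp Require Import all_boot all_order all_algebra.
From mathcomp Require Import all_classical all_reals all_analysis.
From mathcomp Require Import finmap measurable_realfun exponential_distribution ring lra.
Set Implicit Arguments.
Unset Strict Implicit.
Unset Printing Implicit Defensive.
Import Order.TTheory GRing.Theory Num.Theory.
Import numFieldNormedType.Exports.
Local Open Scope classical_set_scope.
Local Open Scope ring_scope.

(** * Nonnegative series and uniqueness of power series coefficients *)

Section series_tools.
Context {R : realType}.

(** No conditional expectation appears. The martingale property is an equality of integrals over
    events of the history [Z_0, ..., Z_n]; as [Z] is integer-valued, such an event is split along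
    the values of [Z_n] or of a hitting time, and the pieces are summed. The main obstacle is thus
    the independence of an arbitrary history event from the offspring numbers of the current
    generation. A subsequence with small [Pi_n] is enough because the existence of the limit comes
    from the martingale, not from the tail bounds. The mean of the limit needs no uniform
    integrability: its tail [exp(-x / R) / R], with [R = R_infty], is itself the density of the
    exponential law with rate [1 / R], so it integrates to one. *)

Lemma nneseries_EFinP {u : nat -> R} {l : R} : (forall k, 0 <= u k) ->
  (\sum_(0 <= k <oo) (u k)%:E = l%:E)%E <-> series u @ \oo --> l.
Proof.
move=> u0.
have E : (fun n => \sum_(0 <= k < n) (u k)%:E)%E = EFin \o series u.
  by apply/funext => n; rewrite /= sumEFin.
split => [sl|sl].
  have /cvg_ex[/= l' cl'] : cvgn (fun n => \sum_(0 <= k < n) (u k)%:E)%E.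
    by apply: is_cvg_nneseries => n _ _; rewrite lee_fin.
  have := cvg_lim (@ereal_hausdorff R) cl'; rewrite sl => l'E.
  by move: cl'; rewrite -l'E E => /fine_cvgP[].
apply/cvg_lim; first exact: ereal_hausdorff.
by rewrite E; apply: cvg_EFin; [exact: nearW | exact: sl].
Qed.

(* If d m is the first nonzero coefficient, bounding the tail by a geometric
   series gives |d m| <= 2 s / (1 - s), which fails for small s. *)
Lemma power_series_eq0 (d : nat -> R) : (forall k, `|d k| <= 2) ->
  (forall s, 0 <= s < 1 -> series (fun k => d k * s ^+ k) @ \oo --> 0) ->
  forall k, d k = 0.
Proof.
move=> d2 ds; elim/ltn_ind => m IH; apply/eqP; apply/negP => /negP dm0.
have dm : 0 < `|d m| by rewrite normr_gt0.
(* Chosen so that [2 * s / (1 - s)] is half of the absolute value of [d m]. *)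
pose s := `|d m| / (4 + `|d m|).
have d40 : 0 < 4 + `|d m| by lra.
have s0 : 0 < s by rewrite divr_gt0.
have s1 : s < 1 by rewrite ltr_pdivrMr// mul1r; lra.
have tail n : `|\sum_(0 <= k < n) d (m.+1 + k)%N * s ^+ (m.+1 + k)%N|
    <= 2 * s ^+ m.+1 / (1 - s).
  apply: (le_trans (ler_norm_sum _ _ _)).
  apply: (@le_trans _ _ (\sum_(0 <= k < n) 2 * s ^+ m.+1 * s ^+ k)).
    apply: ler_sum => k _; rewrite normrM (ger0_norm (exprn_ge0 _ (ltW s0))).
    by rewrite exprD -[leRHS]mulrA ler_wpM2r// mulr_ge0// exprn_ge0// ltW.
  have := geometric_seriesE (2 * s ^+ m.+1) (negbT (lt_eqF s1)).
  move=> /(congr1 (fun f => f n)); rewrite /series/= => ->.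
  rewrite ler_pM2r ?invr_gt0 ?subr_gt0// ler_piMr//.
    by rewrite mulr_ge0// exprn_ge0// ltW.
  by rewrite lerBlDr lerDl exprn_ge0// ltW.
have head n : series (fun k => d k * s ^+ k) (m.+1 + n)%N =
   d m * s ^+ m + \sum_(0 <= k < n) d (m.+1 + k)%N * s ^+ (m.+1 + k)%N.
  rewrite /series/= (big_cat_nat (n := m.+1))//=; last by rewrite leq_addr.
  congr (_ + _).
    rewrite big_nat_recr//= big_nat big1 ?add0r// => i /andP[_ im].
    by rewrite IH// mul0r.
  rewrite -{1}[m.+1]add0n big_addn addKn.
  by apply: eq_bigr => i _; rewrite addnC.
have key : `|d m * s ^+ m| <= 2 * s ^+ m.+1 / (1 - s).
  apply/ler_addgt0Pr => e e0.
  have s01 : 0 <= s < 1 by rewrite ltW.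
  have /cvgrPdist_le/(_ _ e0)[N _ HN] := ds s s01.
  have := HN (m.+1 + N)%N (leq_addl _ _); rewrite /= sub0r normrN head => H.
  set t := (\sum_(0 <= _ < N) _) in H.
  have -> : d m * s ^+ m = (d m * s ^+ m + t) - t by ring.
  by apply: (le_trans (ler_normB _ _)); rewrite addrC lerD// tail.
move: key; rewrite normrM (ger0_norm (exprn_ge0 _ (ltW s0))) exprS.
have -> : 2 * (s * s ^+ m) / (1 - s) = (2 * s / (1 - s)) * s ^+ m by ring.
rewrite ler_pM2r ?exprn_gt0//.
have -> : 2 * s / (1 - s) = `|d m| / 2 by rewrite /s; field; lra.
lra.
Qed.

End series_tools.

(** * Integer-valued variables; tails and mean of linear fractional laws *)

Section nat_valued.
Context {R : realType} {d} {Omega : measurableType d} (P : probability Omega R).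

Lemma measurable_fun_nat_comp d' (T : measurableType d') (X : Omega -> nat)
    (Y : nat -> T) :
  (forall k, measurable (X @^-1` [set k])) -> measurable_fun setT (Y \o X).
Proof.
move=> mX _ B mB; rewrite setTI.
have -> : (Y \o X) @^-1` B = \bigcup_(k in Y @^-1` B) X @^-1` [set k].
  by apply/seteqP; split => w /=; [move=> ?; exists (X w)|case=> k Bk ->].
by apply: bigcup_measurable.
Qed.

Lemma measurable_nat_preimage (X : Omega -> nat) (V : set nat) :
  (forall k, measurable (X @^-1` [set k])) -> measurable (X @^-1` V).
Proof.
move=> mX; have -> : X @^-1` V = \bigcup_(k in V) X @^-1` [set k].
  by apply/seteqP; split => w /=; [move=> ?; exists (X w)|case=> k Bk ->].
by apply: bigcup_measurable.
Qed.

Lemma measurable_fun_natR (X : Omega -> nat) (g : nat -> R) (D : set Omega) :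
  (forall k, measurable (X @^-1` [set k])) ->
  measurable_fun D (fun w => (g (X w))%:E).
Proof.
move=> mX; apply: measurable_funTS.
exact: (@measurable_fun_nat_comp _ _ X (fun k => (g k)%:E)).
Qed.

Lemma integral_nat_fiber (X : Omega -> nat) (H : set Omega) (g : Omega -> \bar R) :
  (forall k, measurable (X @^-1` [set k])) -> measurable H ->
  measurable_fun setT g -> (forall w, (0 <= g w)%E) ->
  (\int[P]_(w in H) g w =
   \sum_(0 <= k <oo) \int[P]_(w in H `&` X @^-1` [set k]) g w)%E.
Proof.
move=> mX mH mg g0.
have HE : H = \bigcup_k (H `&` X @^-1` [set k]).
  by apply/seteqP; split => [w Hw|w [k _ []]//]; exists (X w).
rewrite {1}HE ge0_integral_bigcup//.
- by move=> k; apply: measurableI.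
- exact: measurable_funTS.
- by move=> i j _ _ [w [[_ /= <-] [_ /= <-]]].
Qed.

Lemma integral_nat (X : Omega -> nat) (H : set Omega) (g : nat -> R) :
  (forall k, measurable (X @^-1` [set k])) -> measurable H ->
  (forall k, 0 <= g k) ->
  (\int[P]_(w in H) (g (X w))%:E =
   \sum_(0 <= k <oo) ((g k)%:E * P (H `&` X @^-1` [set k])))%E.
Proof.
move=> mX mH g0; rewrite (@integral_nat_fiber X)//; last 2 first.
- exact: measurable_fun_natR.
- by move=> w; rewrite lee_fin.
apply: eq_eseriesr => k _.
rewrite (eq_integral (cst (g k)%:E)) ?integral_cst//.
  by apply: measurableI.
by move=> w /set_mem[_ /= ->].
Qed.

Lemma integral_nat_tails (X : Omega -> nat) :
  (forall k, measurable (X @^-1` [set k])) ->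
  (\int[P]_w ((X w)%:R)%:E = \sum_(0 <= k <oo) P [set w | (k < X w)%N])%E.
Proof.
move=> mX.
have mt k : measurable [set w | (k < X w)%N].
  exact: (@measurable_nat_preimage X [set n | (k < n)%N]).
transitivity (\int[P]_w (\sum_(0 <= k <oo) (\1_[set w | (k < X w)%N] w)%:E))%E.
  apply: eq_integral => w _; apply/esym/nneseries_EFinP.
    by move=> k; rewrite indicE.
  apply: cvg_near_cst; exists (X w) => // n /= Xn.
  rewrite /series/= (big_cat_nat (n := X w))//= [X in _ + X]big_nat_cond [X in _ + X]big1.
    rewrite addr0 big_nat_cond (eq_bigr (fun=> 1)).
      by rewrite -big_nat_cond big_const_nat iter_addr subn0 addr0.
    by move=> i /andP[/andP[_ iX] _]; rewrite indicE mem_set.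
  by move=> i /andP[/andP[iX _] _]; rewrite indicE memNset//=; apply/negP; rewrite -leqNgt.
rewrite integral_nneseries//.
- by apply: eq_eseriesr => k _; rewrite integral_indic// setIT.
- by move=> k; apply/measurable_EFinP; exact: measurable_indic.
Qed.

(** The defining relation solved for [f], with [f(s)] as the expectation of [s ^ X]: this can be
    computed for [Z_n] by conditioning, before its mass function is known. *)
Definition has_lf_pgf (a b : R) (X : Omega -> nat) : Prop :=
  forall s : R, 0 <= s < 1 ->
    (\int[P]_w (s ^+ X w)%:E = (1 - (a / (1 - s) + b)^-1)%:E)%E.

(** With [c = a + b] and [q = b / c], the generating function expands as
    [1 - 1/c + (1/c) (1 - q) s / (1 - q s)]. Uniqueness of coefficients gives an atom at 0 plus a
    geometric part, and the tails follow by induction on [k]. *)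
Lemma lf_tail (a b : R) (X : Omega -> nat) : 0 < a -> 0 <= b ->
  (forall k, measurable (X @^-1` [set k])) -> has_lf_pgf a b X ->
  forall k, P [set w | (k < X w)%N] = ((b / (a + b)) ^+ k / (a + b))%:E.
Proof.
move=> a0 b0 mX pgf.
set c := a + b; set q := b / c.
have c0 : 0 < c by rewrite ltr_wpDr.
have q0 : 0 <= q by rewrite divr_ge0// ltW.
have q1 : q < 1 by rewrite ltr_pdivrMr// mul1r /c; lra.
have qE : 1 - q = a / c by rewrite /q /c; field; rewrite gt_eqF.
have ci0 : 0 < c^-1 by rewrite invr_gt0.
have ci1 : c^-1 <= 1.
  (* At [s = 0] the integral is [P(X = 0)], so [1 - 1/c] is nonnegative. *)
  have := pgf 0; rewrite lexx ltr01 => /(_ isT) E.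
  have : (0 <= \int[P]_w (0 ^+ X w : R)%:E)%E.
    by apply: integral_ge0 => w _; rewrite lee_fin exprn_ge0.
  by rewrite E lee_fin subr0 divr1 subr_ge0.
pose p k := fine (P (X @^-1` [set k])).
have pE k : P (X @^-1` [set k]) = (p k)%:E by rewrite fineK// fin_num_measure.
have p0 k : 0 <= p k by rewrite fine_ge0.
have p1 k : p k <= 1 by rewrite -lee_fin -pE probability_le1.
pose u k : R := if k is k'.+1 then c^-1 * (1 - q) * q ^+ k' else 1 - c^-1.
have cp s : 0 <= s < 1 -> series (fun k => p k * s ^+ k) @ \oo --> 1 - (a / (1 - s) + b)^-1.
  move=> s01; have s0 : 0 <= s by case/andP: s01.
  apply/nneseries_EFinP; first by move=> k; rewrite mulr_ge0// exprn_ge0.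
  rewrite -pgf// (@integral_nat X setT (fun k => s ^+ k))//; last first.
    by move=> k; exact: exprn_ge0.
  by apply: eq_eseriesr => k _; rewrite setTI pE EFinM muleC.
have cu s : 0 <= s < 1 -> series (fun k => u k * s ^+ k) @ \oo --> 1 - (a / (1 - s) + b)^-1.
  move=> /andP[s0 s1]; rewrite -cvg_shiftS/=.
  have -> : (fun n => series (fun k => u k * s ^+ k) n.+1) =
     (fun n => (1 - c^-1) + series (geometric (c^-1 * (1 - q) * s) (q * s)) n).
    apply/funext => n; rewrite /series/= big_nat_recl//= expr0 mulr1.
    by congr (_ + _); apply: eq_bigr => i _; rewrite [(q * s) ^+ _]exprMn exprS; ring.
  have qs1 : q * s < 1 by rewrite mulr_ilt1.
  have -> : 1 - (a / (1 - s) + b)^-1 = 1 - c^-1 + c^-1 * (1 - q) * s * (1 - q * s)^-1.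
    have e1 : a + b * (1 - s) != 0 by rewrite gt_eqF// ltr_wpDr// mulr_ge0// subr_ge0 ltW.
    have e2 : 1 - s != 0 by rewrite subr_eq0 gt_eqF.
    have e3 : a + b != 0 by rewrite gt_eqF.
    have -> : a / (1 - s) + b = (a + b * (1 - s)) / (1 - s) by field.
    have -> : 1 - q * s = (a + b * (1 - s)) / c by rewrite /q /c; field.
    by rewrite qE /c; field; rewrite e1 e3.
  apply: cvgD; first exact: cvg_cst.
  by apply: cvg_geometric_series; rewrite ger0_norm// mulr_ge0.
have pu k : p k = u k.
  apply/eqP; rewrite -subr_eq0; apply/eqP; move: k; apply: power_series_eq0.
    move=> k; have u01 : 0 <= u k <= 1.
      case: k => [|k] /=; first by rewrite subr_ge0 ci1 lerBlDr lerDl ltW.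
      have qk0 := exprn_ge0 k q0; have qk1 := exprn_ile1 k q0 (ltW q1).
      have q10 : 0 <= 1 - q by rewrite subr_ge0 ltW.
      have q11 : 1 - q <= 1 by rewrite lerBlDr lerDl.
      have cq0 : 0 <= c^-1 * (1 - q) by rewrite mulr_ge0// ltW.
      have cq1 : c^-1 * (1 - q) <= 1 by rewrite mulr_ile1// ltW.
      by rewrite mulr_ge0//= mulr_ile1.
    by have := p0 k; have := p1 k; case/andP: u01 => *; rewrite ler_norml; lra.
  move=> s s01; rewrite -(subrr (1 - (a / (1 - s) + b)^-1)).
  have -> : series (fun k => (p k - u k) * s ^+ k) =
     series (fun k => p k * s ^+ k) - series (fun k => u k * s ^+ k).
    apply/funext => n; rewrite /series/= fctE -sumrB.
    by apply: eq_bigr => i _; rewrite mulrBl.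
  by apply: cvgB; [exact: cp|exact: cu].
have mt k : measurable [set w | (k < X w)%N].
  exact: (@measurable_nat_preimage X [set n | (k < n)%N]).
elim => [|k IH].
  have -> : [set w | (0 < X w)%N] = ~` (X @^-1` [set 0%N]).
    by apply/seteqP; split => w /=; rewrite lt0n => /eqP.
  by rewrite probability_setC// pE pu/= -EFinB expr0 mul1r; congr EFin; ring.
have : P [set w | (k < X w)%N] = (P (X @^-1` [set k.+1]) + P [set w | (k.+1 < X w)%N])%E.
  rewrite -measureU//; last first.
    by apply/seteqP; split => w //= -[->]; rewrite ltnn.
  congr (P _); apply/seteqP; split => w /=; rewrite [(k < _)%N]leq_eqVlt.
    by case/orP => [/eqP<-|]; [left|right].
  by case=> [->|->]; rewrite ?eqxx ?orbT.
rewrite IH pE pu/= -[P _]fineK ?fin_num_measure// -EFinD => -[E].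
by congr EFin; rewrite exprSr; move: E; set t := fine _; lra.
Qed.

(** The geometric tails sum to [(1/c) / (1 - q)] with [c = a + b], [q = b / c], and
    [c (1 - q) = a]. *)
Lemma lf_mean (a b : R) (X : Omega -> nat) : 0 < a -> 0 <= b ->
  (forall k, measurable (X @^-1` [set k])) -> has_lf_pgf a b X ->
  (\int[P]_w ((X w)%:R)%:E = (a^-1)%:E)%E.
Proof.
move=> a0 b0 mX pgf; rewrite integral_nat_tails//.
have c0 : 0 < a + b by rewrite ltr_wpDr.
have q0 : 0 <= b / (a + b) by rewrite divr_ge0// ltW.
transitivity (\sum_(0 <= k <oo) (geometric (a + b)^-1 (b / (a + b)) k)%:E)%E.
  by apply: eq_eseriesr => k _; rewrite (lf_tail a0 b0)// mulrC.
apply/nneseries_EFinP; first by move=> k; rewrite geometric_ge0// invr_ge0 ltW.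
have -> : a^-1 = (a + b)^-1 / (1 - b / (a + b)) by field; lra.
by apply: cvg_geometric_series; rewrite ger0_norm// ltr_pdivrMr// mul1r; lra.
Qed.

End nat_valued.

(** * Events independent of the variables outside a set of indices *)

Section independence.
Context {R : realType} {d} {Omega : measurableType d} (P : probability Omega R).
Context {I : choiceType} (X : I -> Omega -> nat).
Hypothesis mX : forall i k, measurable (X i @^-1` [set k]).

(* A substitute for "H belongs to sigma(X_j, j in J)" that is
   directly stable under countable disjoint unions and under intersection with
   {X_i in V}, so that generated sigma-algebras can be avoided. *)
Definition indep_off (J : set I) (H : set Omega) : Prop :=
  measurable H /\
  forall (L : {fset I}) (V : I -> set nat), (forall i, i \in L -> ~ J i) ->
    P (H `&` \bigcap_(i in [set` L]) (X i @^-1` V i)) =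
    (P H * \prod_(i <- L) P (X i @^-1` V i))%E.

Lemma measurable_cylinder (L : {fset I}) (V : I -> set nat) :
  measurable (\bigcap_(i in [set` L]) (X i @^-1` V i)).
Proof.
apply: fin_bigcap_measurable; first exact: finite_fset.
by move=> i _; apply: measurable_nat_preimage.
Qed.

Lemma indep_off_sub (J J' : set I) (H : set Omega) :
  J `<=` J' -> indep_off J H -> indep_off J' H.
Proof.
by move=> JJ' [mH iH]; split=> // L V LJ'; apply: iH => i /LJ' ? /JJ'.
Qed.

Lemma indep_off_set0 (J : set I) : indep_off J set0.
Proof. by split=> // L V _; rewrite set0I measure0 mul0e. Qed.

Lemma indep_off_setT (J : set I) :
  mutually_independent_nat P X -> indep_off J setT.
Proof. by move=> iX; split=> // L V _; rewrite setTI iX probability_setT mul1e. Qed.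

Lemma indep_off_preimage (J : set I) (H : set Omega) (i : I) (V : set nat) :
  indep_off J H -> ~ J i -> P (H `&` X i @^-1` V) = (P H * P (X i @^-1` V))%E.
Proof.
move=> [_ iH] Ji; have := iH [fset i]%fset (fun=> V).
rewrite big_seq_fset1 set_fset1 bigcap_set1; apply.
by move=> j; rewrite inE => /eqP ->.
Qed.

Lemma indep_off_setI (J : set I) (H : set Omega) (i : I) (V : set nat) :
  indep_off J H -> ~ J i -> indep_off (i |` J) (H `&` X i @^-1` V).
Proof.
move=> iH Ji; have [mH iH'] := iH; split.
  by apply: measurableI => //; apply: measurable_nat_preimage.
move=> L U LJ.
have iL : i \notin L by apply/negP => /LJ; apply; left.
rewrite (indep_off_preimage V iH Ji).
have prodV : (\prod_(j <- L) P (X j @^-1` (if j == i then V else U j)) =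
    \prod_(j <- L) P (X j @^-1` U j))%E.
  rewrite big_seq [RHS]big_seq; apply: eq_bigr => j jL.
  by case: eqP => // E; move: iL; rewrite -E jL.
have := iH' (i |` L)%fset (fun j => if j == i then V else U j).
rewrite big_fsetU1//= eqxx prodV.
rewrite muleA => <-; last first.
  move=> j; rewrite !inE => /orP[/eqP->//|/LJ jJ jJ']; by apply: jJ; right.
congr (P _); rewrite -setIA; congr (_ `&` _).
apply/seteqP; split => w /=.
  move=> [Vi Uj] j /=; rewrite !inE => /orP[/eqP->|jL]; first by rewrite eqxx.
  by case: eqP => [->//|_]; exact: Uj.
move=> UV; split; first by have /= := UV i; rewrite !inE eqxx => /(_ isT).
move=> j /= jL; have /= := UV j; rewrite !inE jL orbT => /(_ isT).
by case: eqP => // E; move: iL; rewrite -E jL.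
Qed.

Lemma indep_off_bigcup (J : set I) (F : nat -> set Omega) :
  (forall k, indep_off J (F k)) -> trivIset setT F -> indep_off J (\bigcup_k F k).
Proof.
move=> iF tF; have mF k : measurable (F k) by case: (iF k).
split; first exact: bigcup_measurable.
move=> L V LJ.
have tF' E : trivIset setT (fun k => F k `&` E).
  by move=> i j _ _ [w [[Fi _] [Fj _]]]; apply: tF => //; exists w.
rewrite setI_bigcupl measure_bigcup//; last first.
  by move=> k _; apply: measurableI => //; exact: measurable_cylinder.
rewrite measure_bigcup//.
set c := (\prod_(_ <- _) _)%E.
have cfin : c \is a fin_num.
  rewrite /c; apply: prode_fin_num => i _; apply: fin_num_measure.
  exact: measurable_nat_preimage.
rewrite -(fineK cfin) muleC -nneseriesZl//.
by apply: eq_eseriesr => k _; rewrite fineK// [RHS]muleC; case: (iF k) => _; apply.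
Qed.

Lemma indep_off_bigcup_count (T : countType) (J : set I) (F : T -> set Omega) :
  (forall t, indep_off J (F t)) ->
  (forall t t' w, F t w -> F t' w -> t = t') ->
  indep_off J (\bigcup_t F t).
Proof.
move=> iF dF.
(* Codes without preimage give the empty set. As [pickle_inv] returns [t] only at the code of [t],
   no [F t] is listed twice and disjointness survives. *)
pose G n := if @pickle_inv T n is Some t then F t else set0.
have -> : \bigcup_t F t = \bigcup_n G n.
  apply/seteqP; split => w [t _ tw].
    by exists (choice.pickle t) => //; rewrite /G pickleK_inv.
  by move: tw; rewrite /G; case: pickle_inv => // t' ?; exists t'.
apply: indep_off_bigcup.
  by move=> n; rewrite /G; case: pickle_inv => //; exact: indep_off_set0.
move=> m n _ _ [w []]; rewrite /G.
case Em: pickle_inv => [t|//]; case En: pickle_inv => [t'|//] Ft Ft'.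
have tt := dF _ _ _ Ft Ft'; subst t'.
have := @choice.pickle_invK T m; have := @choice.pickle_invK T n.
by rewrite Em En /= => <- <-.
Qed.

(** Induction on the number of summands: once the partial sum is [k <= m], the last term must be
    [m - k]. This gives finitely many disjoint pieces, each absorbing one further index. *)
Lemma indep_off_sum (z m : nat) (g : nat -> I) (J : set I) (H : set Omega) :
  indep_off J H -> (forall i, (i < z)%N -> ~ J (g i)) -> injective g ->
  indep_off (J `|` [set g i | i in [set i | (i < z)%N]])
    (H `&` [set w | (\sum_(i < z) X (g i) w)%N = m]).
Proof.
move=> iH Jg gi; elim: z m Jg => [|z IH] m Jg.
  case: m => [|m].
    apply: (@indep_off_sub J); first by move=> ? ?; left.
    by have -> : H `&` [set w | (\sum_(i < 0) X (g i) w)%N = 0%N] = H;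
      [apply/seteqP; split => w //=; [case|rewrite big_ord0]|].
  have -> : H `&` [set w | (\sum_(i < 0) X (g i) w)%N = m.+1] = set0.
    by apply/seteqP; split => w //= []; rewrite big_ord0.
  exact: indep_off_set0.
have -> : H `&` [set w | (\sum_(i < z.+1) X (g i) w)%N = m] =
  \bigcup_(k : 'I_m.+1) ((H `&` [set w | (\sum_(i < z) X (g i) w)%N = k])
    `&` X (g z) @^-1` [set (m - k)%N]).
  apply/seteqP; split => w.
    move=> [Hw /=]; rewrite big_ord_recr/= => E.
    have km : (\sum_(i < z) X (g i) w < m.+1)%N by rewrite ltnS -E leq_addr.
    by exists (Ordinal km) => //=; split => //; rewrite -E addKn.
  move=> [k _ [[Hw /= Ek] E]]; split => //=; rewrite big_ord_recr/= Ek E subnKC//.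
  by rewrite -ltnS.
apply: indep_off_bigcup_count.
  move=> k; have := @indep_off_setI _ _ (g z) [set (m - k)%N] (IH k _).
  move=> /(_ (fun i iz => Jg i (leqW iz))) iz.
  apply: (indep_off_sub _ (iz _)).
    move=> i [->|[Ji|[j /= jz <-]]]; [by right; exists z => /=|by left|].
    by right; exists j => //=; exact: leqW.
  move=> [/Jg|[j /= jz /gi jz']]; first exact.
  by move: jz; rewrite jz' ltnn.
move=> k k' w [[_ /= E] _] [[_ /= E'] _].
by apply/val_inj; rewrite /= -E -E'.
Qed.

End independence.

(** * Expectations and generating functions of independent sums *)

Section independence_integral.
Context {R : realType} {d} {Omega : measurableType d} (P : probability Omega R).
Context {I : choiceType} (X : I -> Omega -> nat).
Hypothesis mX : forall i k, measurable (X i @^-1` [set k]).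

Lemma indep_off_integral (J : set I) (H : set Omega) (i : I) (g : nat -> R) :
  indep_off P X J H -> ~ J i -> (forall k, 0 <= g k) ->
  (\int[P]_(w in H) (g (X i w))%:E = P H * \int[P]_w (g (X i w))%:E)%E.
Proof.
move=> iH Ji g0; have [mH _] := iH.
rewrite !integral_nat// -(fineK (fin_num_measure P _ mH)) -nneseriesZl; last first.
  by move=> k _; rewrite setTI mule_ge0// lee_fin.
apply: eq_eseriesr => k _.
by rewrite (indep_off_preimage _ iH Ji) setTI fineK ?fin_num_measure// muleCA.
Qed.

Hypothesis iX : mutually_independent_nat P X.

Lemma measurable_sum_fiber (g : nat -> I) (z m : nat) : injective g ->
  measurable ((fun w => \sum_(i < z) X (g i) w)%N @^-1` [set m]).
Proof.
move=> gi; have := indep_off_sum mX m (indep_off_setT set0 iX) (fun i (_ : (i < z)%N) => id) gi.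
by rewrite setTI => -[].
Qed.

(** [J] and [H] vary in the induction because the last summand is removed by fixing its value: each
    event [X (g z) = k] is absorbed into [H], and summing over [k] produces one further factor
    [f]. *)
Lemma indep_off_pgf_sum (g : nat -> I) (s f : R) : injective g -> 0 <= s ->
  (forall i, \int[P]_w (s ^+ X (g i) w)%:E = f%:E)%E ->
  forall (z : nat) (J : set I) (H : set Omega),
  indep_off P X J H -> (forall i, (i < z)%N -> ~ J (g i)) ->
  (\int[P]_(w in H) (s ^+ (\sum_(i < z) X (g i) w))%:E = P H * (f ^+ z)%:E)%E.
Proof.
move=> gi s0 sf; elim => [|z IH] J H iH Jg; have [mH _] := iH.
  rewrite (eq_integral (cst 1%:E)) ?integral_cst//.
    by rewrite mul1e expr0 mule1.
  by move=> w _; rewrite big_ord0 expr0.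
rewrite (@integral_nat_fiber _ _ _ _ (X (g z)))//; last 2 first.
- exact: (@measurable_fun_natR _ _ _ _ (fun n => s ^+ n) setT
    (fun k => measurable_sum_fiber z.+1 k gi)).
- by move=> w; rewrite lee_fin exprn_ge0.
have f0 : 0 <= f.
  rewrite -lee_fin -(sf 0%N); apply: integral_ge0 => w _.
  by rewrite lee_fin exprn_ge0.
transitivity (\sum_(0 <= k <oo) ((f ^+ z)%:E * ((s ^+ k)%:E * P (H `&` X (g z) @^-1` [set k]))))%E.
  apply: eq_eseriesr => k _.
  have iHk := indep_off_setI mX [set k] iH (Jg z (ltnSn z)).
  have [mHk _] := iHk.
  rewrite (eq_integral (fun w => (s ^+ k)%:E * (s ^+ (\sum_(i < z) X (g i) w))%:E)%E); last first.
    by move=> w /set_mem[_ /= E]; rewrite big_ord_recr/= E addnC exprD EFinM.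
  rewrite ge0_integralZl_EFin//.
  - rewrite (IH _ _ iHk); first by rewrite muleA muleC.
    move=> i iz [/gi iE|]; first by move: iz; rewrite iE ltnn.
    by apply: Jg; exact: leqW.
  - by move=> w _; rewrite lee_fin exprn_ge0.
  - exact: (@measurable_fun_natR _ _ _ _ (fun n => s ^+ n) _
      (fun k => measurable_sum_fiber z k gi)).
  - exact: exprn_ge0.
rewrite nneseriesZl; last by move=> k _; rewrite mule_ge0// lee_fin exprn_ge0.
rewrite -(@integral_nat _ _ _ _ (X (g z)) H (fun k => s ^+ k))//; last first.
  by move=> k; exact: exprn_ge0.
rewrite (@indep_off_integral _ _ _ (fun k => s ^+ k) iH (Jg z (ltnSn z))); last first.
  by move=> k; exact: exprn_ge0.
by rewrite sf exprS EFinM muleCA [(f%:E * _)%E]muleC.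
Qed.

End independence_integral.

(** The set of admissible histories is arbitrary, so the histories realized in [F] can serve as [S].
    In the form of invariance, intersections and hitting times are easy to handle. *)
Lemma in_natural_filtrationP (Omega : Type) (Z : nat -> Omega -> nat) n F :
  in_natural_filtration Z n F <->
  (forall w w', (forall k, (k <= n)%N -> Z k w = Z k w') -> F w -> F w').
Proof.
split=> [[S ->] w w' Zww'|Fww'].
  suff /(congr1 S) /= -> : [seq Z k w | k <- iota 0 n.+1] = [seq Z k w' | k <- iota 0 n.+1] by [].
  by apply/eq_in_map => k; rewrite mem_iota add0n ltnS => /andP[_]; exact: Zww'.
exists [set s | exists2 w, F w & s = [seq Z k w | k <- iota 0 n.+1]].
apply/seteqP; split=> [w Fw/=|w [w' Fw' /eq_in_map E]]; first by exists w.
by apply: Fww' Fw' => k kn; apply/esym/E; rewrite mem_iota add0n ltnS.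
Qed.

(** * The Galton-Watson process in a fixed environment *)

Section galton_watson.
Context {R : realType} {d} {Omega : measurableType d} (P : probability Omega R).
Context (a b : nat -> R) (xi : nat -> nat -> Omega -> nat) (Z : nat -> Omega -> nat).
Hypotheses (a0 : forall n, 0 < a n) (b0 : forall n, 0 < b n).
Hypothesis gw : LF_GW_process P a b xi Z.

Let X (ni : nat * nat) := xi ni.1 ni.2.
Let past n : set (nat * nat) := [set ni | (ni.1 < n)%N].

Let mX ni k : measurable (X ni @^-1` [set k]).
Proof. by case: gw => mxi _ _ _ _; exact: mxi. Qed.

Let iX : mutually_independent_nat P X.
Proof. by case: gw => _ iX _ _ _; exact: iX. Qed.

Lemma gw_offspring_pgf n i : has_lf_pgf P (a n) (b n) (xi n i).
Proof.
case: gw => mxi _ /(_ n i)[p0 p1 pE] _ _ s s01; have /andP[s0 s1] := s01.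
rewrite -(pE s s01) invrK opprB addrC subrK.
rewrite (@integral_nat _ _ _ _ (xi n i) setT (fun k => s ^+ k))//; last first.
  by move=> k; exact: exprn_ge0.
under eq_eseriesr do rewrite setTI muleC
  -(fineK (fin_num_measure P _ (mxi _ _ _))) -EFinM.
apply/nneseries_EFinP; first by move=> k; rewrite mulr_ge0 ?exprn_ge0 ?p0.
(* [LF_law] speaks of [limn], which is a true limit only for a convergent series; domination by the
   mass function, which sums to one, provides convergence. *)
have : cvgn (series (fun k => fine (P (xi n i @^-1` [set k])) * s ^+ k)).
  apply: (@series_le_cvg _ _ (fun k => fine (P (xi n i @^-1` [set k])))).
  - by move=> k; rewrite mulr_ge0 ?exprn_ge0 ?p0.
  - exact: p0.
  - by move=> k; rewrite ler_piMr ?p0// exprn_ile1// ltW.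
  - by apply/cvg_ex; exists 1.
by [].
Qed.

(** Each generation adds to the history only a sum of [Z_n] offspring numbers of generation [n].
    With [Z_n] and [Z_(n.+1)] fixed, [F] is an event of the earlier history intersected with an
    event on such a sum. At time 0 the history is trivial because [Z_0 = 1]. *)
Lemma gw_natural_indep n F :
  in_natural_filtration Z n F -> indep_off P X (past n) F.
Proof.
case: gw => _ _ _ Z0 ZS.
elim: n F => [|n IH] F /in_natural_filtrationP FZ.
  have [[w0 Fw0]|nF] := pselect (exists w, F w).
    have -> : F = setT.
      apply/seteqP; split => // w _; apply: FZ Fw0 => k.
      by rewrite leqn0 => /eqP ->; rewrite !Z0.
    exact: indep_off_setT.
  have -> : F = set0 by apply/seteqP; split => // w Fw; apply: nF; exists w.
  exact: indep_off_set0.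
(* The histories up to [n] with [Z_n = z] that can be continued inside [F] by [Z_(n.+1) = m]; the
   witness [w'] removes any reference to the future of [w]. *)
pose G z m := [set w | exists w', [/\ F w', Z n.+1 w' = m, Z n w = z &
  forall k, (k <= n)%N -> Z k w' = Z k w]].
have iG z m : indep_off P X (past n) (G z m).
  apply: IH; apply/in_natural_filtrationP => w w' ww' [w1 [Fw1 Zw1 Znw Zw]].
  exists w1; split => //; first by rewrite -ww'.
  by move=> k kn; rewrite Zw// ww'.
have -> : F = \bigcup_(zm : nat * nat)
    (G zm.1 zm.2 `&` [set w | (\sum_(i < zm.1) X (n, nat_of_ord i) w)%N = zm.2]).
  apply/seteqP; split => w.
    move=> Fw; exists (Z n w, Z n.+1 w) => //=; split; last by rewrite ZS.
    by exists w; split.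
  move=> [[z m] _ /= [[w' [Fw' Zw' Znw ww']] E]].
  apply: FZ Fw' => k; rewrite leq_eqVlt => /orP[/eqP->|]; last exact: ww'.
  by rewrite Zw' -E ZS Znw.
apply: indep_off_bigcup_count; first exact: mX.
  move=> [z m]; apply: indep_off_sub (indep_off_sum mX (g := pair n) m (iG z m) _ _).
  - move=> [k j] [|[i iz [<- _]]]; rewrite /past/=; last exact: ltnSn.
    exact: leqW.
  - by move=> i _; rewrite /past/= ltnn.
  - by move=> i j [].
move=> [z m] [z' m'] w /= [[w1 [_ _ <- _]] <-] [[w2 [_ _ -> _]] <-] //.
Qed.

Lemma gw_measurable n k : measurable (Z n @^-1` [set k]).
Proof.
suff /gw_natural_indep[] : in_natural_filtration Z n (Z n @^-1` [set k]) by [].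
by apply/in_natural_filtrationP => w w' ww' /= <-; rewrite ww'.
Qed.

Let fiber_indep n F z : in_natural_filtration Z n F ->
  indep_off P X (past n) (F `&` Z n @^-1` [set z]).
Proof.
move=> /in_natural_filtrationP FZ.
apply/gw_natural_indep/in_natural_filtrationP => w w' ww' [Fw /= <-].
by split; [exact: FZ Fw|rewrite /= ww'].
Qed.

(** Where [Z_n = z], the next generation is a sum of [z] offspring numbers, each independent of the
    event and of mean [1 / a n]. *)
Lemma gw_integral_step n F : in_natural_filtration Z n F ->
  (\int[P]_(w in F) ((Z n.+1 w)%:R)%:E = \int[P]_(w in F) ((Z n w)%:R / a n)%:E)%E.
Proof.
move=> FZ; have [mF _] := gw_natural_indep FZ; have mZ := gw_measurable.
rewrite (@integral_nat_fiber _ _ _ _ (Z n))//; last first.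
  exact: (@measurable_fun_natR _ _ _ (Z n.+1) (fun k => k%:R)).
rewrite [RHS](@integral_nat_fiber _ _ _ _ (Z n))//; last 2 first.
- exact: (@measurable_fun_natR _ _ _ (Z n) (fun k => k%:R / a n)).
- by move=> w; rewrite lee_fin divr_ge0// ltW.
apply: eq_eseriesr => z _; have iH := fiber_indep z FZ.
have [mH _] := iH.
rewrite (eq_integral (fun w => \sum_(i < z) ((X (n, nat_of_ord i) w)%:R)%:E)%E); last first.
  move=> w /set_mem[_ /= Zz]; case: gw => _ _ _ _ ZS.
  by rewrite ZS Zz natr_sum sumEFin.
rewrite [RHS](eq_integral (cst (z%:R / a n)%:E)); last first.
  by move=> w /set_mem[_ /= ->].
rewrite integral_cst// ge0_integral_sum//; last first.
  by move=> i; exact: (@measurable_fun_natR _ _ _ (X (n, nat_of_ord i)) (fun k => k%:R)).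
rewrite (eq_bigr (fun=> P (F `&` Z n @^-1` [set z]) * ((a n)^-1)%:E)%E); last first.
  move=> i _; rewrite (@indep_off_integral _ _ _ _ _ _ mX _ _ _ (fun k => k%:R) iH)//.
    by rewrite (@lf_mean _ _ _ _ (a n) (b n))// ?ltW//; exact: gw_offspring_pgf.
  by rewrite /past/= ltnn.
have pE := fineK (fin_num_measure P _ mH).
rewrite -[P _ in LHS]pE -[X in _ = (_ * X)%E]pE -!EFinM sumEFin sumr_const card_ord.
by rewrite -[LHS]/(_%:E) -mulr_natr; congr (_%:E); ring.
Qed.

Definition Rsum n : R := \sum_(k < n) Pi a k * b k.

(** Averaging over the last generation evaluates the generating function of [Z_n] at the offspring
    one [f], where [1 / (1 - f) = a n / (1 - s) + b n]. The substitution multiplies the slope by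
    [a n] and adds [Pi a n * b n] to the constant. *)
Lemma gw_pgf n : has_lf_pgf P (Pi a n) (Rsum n) (Z n).
Proof.
have mZ := gw_measurable; case: gw => _ _ _ Z0 ZS.
elim: n => [|n IH] s /andP[s0 s1].
  rewrite (eq_integral (cst s%:E)); last by move=> w _; rewrite Z0 expr1.
  rewrite integral_cst// [X in (_ * X)%E](@probability_setT _ _ _ P) mule1.
  rewrite /Pi /Rsum !big_ord0; congr EFin.
  by rewrite addr0 div1r invrK; ring.
set f := 1 - (a n / (1 - s) + b n)^-1.
have sf i : (\int[P]_w (s ^+ X (n, i) w)%:E = f%:E)%E.
  by apply: (gw_offspring_pgf n i); rewrite s0 s1.
have x0 : 0 < a n / (1 - s) + b n by rewrite addr_gt0// divr_gt0// subr_gt0.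
have f01 : 0 <= f < 1.
  rewrite ltrBlDr ltrDl invr_gt0 x0 andbT -lee_fin -(sf 0%N).
  by apply: integral_ge0 => w _; rewrite lee_fin exprn_ge0.
transitivity (\int[P]_w (f ^+ Z n w)%:E)%E; last first.
  rewrite (IH f f01); congr (1 - _^-1)%:E.
  have -> : 1 - f = (a n / (1 - s) + b n)^-1 by rewrite /f; ring.
  rewrite invrK /Pi /Rsum !big_ord_recr/= -/(Pi a n); ring.
rewrite (@integral_nat_fiber _ _ _ _ (Z n))//; last 2 first.
- exact: (@measurable_fun_natR _ _ _ (Z n.+1) (fun k => s ^+ k)).
- by move=> w; rewrite lee_fin exprn_ge0.
rewrite (@integral_nat _ _ _ _ (Z n) setT (fun k => f ^+ k))//; last first.
  by move=> k; rewrite exprn_ge0//; case/andP: f01.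
apply: eq_eseriesr => z _.
have iH : indep_off P X (past n) (setT `&` Z n @^-1` [set z]).
  by apply: fiber_indep; apply/in_natural_filtrationP.
rewrite muleC -(@indep_off_pgf_sum _ _ _ _ _ _ mX iX (pair n) s f _ s0 sf z _ _ iH).
- by apply: eq_integral => w /set_mem[_ /= Zz]; rewrite ZS Zz.
- by move=> i j [].
- by move=> i _; rewrite /past/= ltnn.
Qed.

End galton_watson.

(** [sup S] is the upper limit of [u]. Were [u] infinitely often below [sup S - e], two rationals
    between [sup S - e] and [sup S] would be crossed infinitely often. *)
Lemma bounded_no_upcrossing_cvg {R : realType} (u : nat -> R) (M : R) :
  (forall k, 0 <= u k) -> (forall k, u k <= M) ->
  (forall p q : rat, 0 <= (ratr p : R) -> ratr p < ratr q :> R ->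
    ~ ((forall n, exists2 k, (n <= k)%N & u k <= ratr p) /\
       (forall n, exists2 k, (n <= k)%N & ratr q <= u k))) ->
  exists l : R, u @ \oo --> l.
Proof.
move=> u0 uM npq.
pose S := [set x | forall n, exists2 k, (n <= k)%N & x <= u k].
have S0 : S 0 by move=> n; exists n.
have Sub : has_ubound S.
  by exists M => x /(_ 0%N)[k _ xk]; exact: le_trans xk (uM k).
exists (sup S); apply/cvgrPdist_le => e e0.
have [n1 Hn1] : exists n, forall k, (n <= k)%N -> u k <= sup S + e.
  apply: contrapT => H; have : S (sup S + e).
    move=> n; apply: contrapT => Hn; apply: H; exists n => k nk.
    by rewrite leNgt; apply/negP => /ltW uk; apply: Hn; exists k.
  by move=> /(ub_le_sup Sub); rewrite gerDl leNgt e0.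
have [n2 Hn2] : exists n, forall k, (n <= k)%N -> sup S - e <= u k.
  apply: contrapT => H.
  have low n : exists2 k, (n <= k)%N & u k < sup S - e.
    apply: contrapT => Hn; apply: H; exists n => k nk.
    by rewrite leNgt; apply/negP => uk; apply: Hn; exists k.
  have see : sup S - e < sup S by rewrite gtrBl.
  have [p] := rat_in_itvoo see; rewrite in_itv/= => /andP[ep ps].
  have [q] := rat_in_itvoo ps; rewrite in_itv/= => /andP[pq qs].
  apply: (npq p q _ pq).
    by have [k _ /ltW uk] := low 0%N; rewrite (le_trans (u0 k))// (le_trans uk)// ltW.
  split => n; first by have [k nk uk] := low n; exists k => //; exact/ltW/(lt_trans uk).
  have [x Sx qx] := sup_gt (ex_intro _ 0 S0) qs.
  by have [k nk xk] := Sx n; exists k => //; rewrite (le_trans (ltW qx)).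
near=> k; rewrite ler_distl; apply/andP; split.
  by rewrite lerBlDr; apply: Hn1; near: k; exists n1.
by rewrite -lerBlDr; apply: Hn2; near: k; exists n2.
Unshelve. all: by end_near. Qed.

(** * Almost sure convergence of nonnegative martingales *)

Section martingale_convergence.
Context {R : realType} {d} {Omega : measurableType d} (P : probability Omega R).
Context (Z : nat -> Omega -> nat) (W : nat -> Omega -> R).
Hypothesis mart : martingale P Z W.
Hypothesis W0 : forall n w, 0 <= W n w.
Hypothesis mnat : forall n F, in_natural_filtration Z n F -> measurable F.

Let mW n D : measurable_fun D (fun w => (W n w)%:E).
Proof. by apply/measurable_EFinP/measurable_funTS; case: mart. Qed.

Let le_prob (A B : set Omega) : measurable A -> measurable B -> A `<=` B -> (P A <= P B)%E.
Proof. by move=> mA mB AB; apply: le_measure => //; rewrite in_setE. Qed.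

Let prob_bigcup (F : nat -> set Omega) : (forall k, measurable (F k)) ->
  trivIset setT F -> P (\bigcup_k F k) = (\sum_(0 <= k <oo) P (F k))%E.
Proof.
move=> mF tF; rewrite measure_bigcup//.
by apply: eq_eseriesl => k; rewrite in_setT.
Qed.

Lemma natural_mono n m F : (n <= m)%N ->
  in_natural_filtration Z n F -> in_natural_filtration Z m F.
Proof.
move=> nm /in_natural_filtrationP FZ; apply/in_natural_filtrationP => w w' ww'.
by apply: FZ => k kn; apply: ww'; exact: leq_trans nm.
Qed.

Lemma martingale_integral n m F : (n <= m)%N -> in_natural_filtration Z n F ->
  (\int[P]_(w in F) (W m w)%:E = \int[P]_(w in F) (W n w)%:E)%E.
Proof.
move=> + FZ; elim: m => [|m IH]; first by rewrite leqn0 => /eqP ->.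
rewrite leq_eqVlt => /orP[/eqP->//|nm].
by case: mart => _ [_ [_ ->]]; [exact: IH|exact: natural_mono FZ].
Qed.

(** Stopping times occur only through these disjoint events, one for each value [k] of the first
    visit to [Q] from time [n] on. *)
Definition first_hit (Q : nat -> set Omega) (n k : nat) : set Omega :=
  [set w | [/\ (n <= k)%N, Q k w & forall j, (n <= j < k)%N -> ~ Q j w]].

Lemma natural_first_hit Q n F k : (forall j, in_natural_filtration Z j (Q j)) ->
  in_natural_filtration Z n F ->
  in_natural_filtration Z k (F `&` first_hit Q n k).
Proof.
move=> QZ FZ; apply/in_natural_filtrationP => w w' ww' [Fw [nk Qw nQ]].
split; first by have /in_natural_filtrationP/(_ w w' ww') := natural_mono nk FZ; apply.
split => //; first by have /in_natural_filtrationP/(_ w w' ww') := QZ k; apply.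
move=> j /andP[nj jk] Qj; apply: (nQ j); first by rewrite nj.
have /in_natural_filtrationP/(_ w' w) := QZ j; apply => // i ij.
by rewrite ww'//; exact/ltnW/(leq_ltn_trans ij).
Qed.

Lemma first_hit_trivIset (F : set Omega) Q n : trivIset setT (fun k => F `&` first_hit Q n k).
Proof.
move=> i j _ _ [w [[_ [ni Qi nQi]] [_ [nj Qj nQj]]]].
have [ij|ji|//] := ltngtP i j.
- by exfalso; apply: (nQj i) => //; rewrite ni.
- by exfalso; apply: (nQi j) => //; rewrite nj.
Qed.

Lemma first_hit_bigcup (F : set Omega) Q n :
  \bigcup_k (F `&` first_hit Q n k) = F `&` [set w | exists2 k, (n <= k)%N & Q k w].
Proof.
apply/seteqP; split => [w [k _ [Fw [nk Qk _]]]|w [Fw [k0 nk0 Qk0]]].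
  by split => //; exists k.
have /ex_minnP[k /andP[nk /asboolP Qk] kmin] :
  exists k, (n <= k)%N && `[< Q k w >] by exists k0; rewrite nk0; apply/asboolP.
exists k => //; split => //; split => // j /andP[nj jk] Qj.
by have := kmin j; rewrite nj leqNgt jk => H; apply/notF/H/asboolP.
Qed.

Let measurable_first_hit Q n F k : (forall j, in_natural_filtration Z j (Q j)) ->
  in_natural_filtration Z n F -> measurable (F `&` first_hit Q n k).
Proof. by move=> QZ FZ; apply: mnat (natural_first_hit k QZ FZ). Qed.

Let above x k : set Omega := [set w | x <= W k w].
Let below x k : set Omega := [set w | W k w <= x].

Let natural_above x k : in_natural_filtration Z k (above x k).
Proof.
have -> : above x k = W k @^-1` `[x, +oo[%classic.
  by apply/seteqP; split => w; rewrite /above/= in_itv/= andbT.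
by case: mart => _ [mZ _]; apply: mZ; exact: measurable_itv.
Qed.

Let natural_below x k : in_natural_filtration Z k (below x k).
Proof.
have -> : below x k = W k @^-1` `]-oo, x]%classic.
  by apply/seteqP; split => w; rewrite /below/= in_itv/=.
by case: mart => _ [mZ _]; apply: mZ; exact: measurable_itv.
Qed.

(** Where level [x] is first reached at [k < N], the integral of [W N] equals that of [W k], hence
    is at least [x] times the probability. These pieces are disjoint parts of [F], and for [N >= n]
    the integral of [W N] over [F] is that of [W n]. *)
Lemma martingale_maximal (x : R) n F : 0 <= x -> in_natural_filtration Z n F ->
  (x%:E * P (F `&` [set w | exists2 k, (n <= k)%N & (x <= W k w)%R])
     <= \int[P]_(w in F) (W n w)%:E)%E.
Proof.
move=> x0 FZ; have mH k := measurable_first_hit k (natural_above x) FZ.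
have tH := @first_hit_trivIset F (above x) n.
rewrite -(first_hit_bigcup F (above x)) measure_bigcup// -nneseriesZl//.
apply: lime_le; first by apply: is_cvg_nneseries => k _ _; rewrite mule_ge0// lee_fin.
exists n => // N /= nN; rewrite big_mkcond/=.
apply: (@le_trans _ _ (\sum_(0 <= k < N)
    \int[P]_(w in F `&` first_hit (above x) n k) (W N w)%:E)%E).
  rewrite big_nat [leRHS]big_nat; apply: lee_sum => k /andP[_ kN].
  rewrite in_setT.
  rewrite (martingale_integral (ltnW kN) (natural_first_hit k (natural_above x) FZ)).
  rewrite -integral_cst//; apply: ge0_le_integral => //.
  by move=> w [_ [_ ? _]]; rewrite lee_fin.
apply: le_trans (nneseries_lim_ge _ _) _.
  by move=> k _ _; apply: integral_ge0 => w _; rewrite lee_fin.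
rewrite -ge0_integral_bigcup//; last by move=> w _; rewrite lee_fin.
rewrite first_hit_bigcup -(martingale_integral nN FZ).
apply: ge0_subset_integral => //.
- by rewrite -first_hit_bigcup; apply: bigcup_measurable.
- exact: mnat FZ.
- by move=> w _; rewrite lee_fin.
Qed.

Let upcross x y : set Omega :=
  [set w | (forall n, exists2 k, (n <= k)%N & W k w <= x) /\
           (forall n, exists2 k, (n <= k)%N & y <= W k w)].

Let measurable_upcross x y : measurable (upcross x y).
Proof.
have -> : upcross x y =
   (\bigcap_n \bigcup_(k in [set k | (n <= k)%N]) below x k) `&`
   (\bigcap_n \bigcup_(k in [set k | (n <= k)%N]) above y k).
  apply/seteqP; split => w [H1 H2]; split => n.
  - by move=> _; have [k ? ?] := H1 n; exists k.
  - by move=> _; have [k ? ?] := H2 n; exists k.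
  - by have [k ? ?] := H1 n Logic.I; exists k.
  - by have [k ? ?] := H2 n Logic.I; exists k.
by apply: measurableI; apply: bigcap_measurable => // n _;
  apply: bigcup_measurable => k _;
  [exact: mnat (natural_below x k)|exact: mnat (natural_above y k)].
Qed.

(* Each further upcrossing costs a factor x / y, conditionally on the past. *)
Let upcross_geometric x y j n F : 0 <= x -> x < y -> in_natural_filtration Z n F ->
  (P (F `&` upcross x y) <= ((x / y) ^+ j)%:E * P F)%E.
Proof.
move=> x0 xy; have y0 : 0 < y by exact: le_lt_trans xy.
have c0 : 0 <= x / y by rewrite divr_ge0// ltW.
elim: j n F => [|j IH] n F FZ.
  rewrite expr0 mul1e; have mF := mnat FZ.
  by apply: le_prob => //; exact: measurableI.
have split_hit Q G m : (forall k, in_natural_filtration Z k (Q k)) ->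
    in_natural_filtration Z m G ->
    (forall w, upcross x y w -> exists2 k, (m <= k)%N & Q k w) ->
    (P (G `&` upcross x y) = \sum_(0 <= k <oo) P ((G `&` first_hit Q m k) `&` upcross x y))%E.
  move=> QZ GZ hitQ; have mH k := measurable_first_hit k QZ GZ.
  have -> : G `&` upcross x y = \bigcup_k ((G `&` first_hit Q m k) `&` upcross x y).
    rewrite -setI_bigcupl first_hit_bigcup -setIA; congr (_ `&` _).
    by apply/seteqP; split => w; [move=> uw; split => //; exact: hitQ|case].
  rewrite prob_bigcup//.
  - by move=> k; apply: measurableI.
  - by apply: trivIset_setIr; exact: first_hit_trivIset.
have mHx k := measurable_first_hit k (natural_below x) FZ.
rewrite (split_hit (below x) _ _ (natural_below x) FZ); last by move=> w [+ _]; exact.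
apply: (@le_trans _ _ (\sum_(0 <= k <oo)
    ((x / y) ^+ j.+1)%:E * P (F `&` first_hit (below x) n k))%E); last first.
  rewrite nneseriesZl//; apply: lee_wpmul2l; first by rewrite lee_fin exprn_ge0.
  rewrite -prob_bigcup//; last exact: first_hit_trivIset.
  apply: le_prob; [exact: bigcup_measurable|exact: mnat FZ|].
  by rewrite first_hit_bigcup; exact: subIsetl.
apply: lee_nneseries => // k _.
have GZ := natural_first_hit k (natural_below x) FZ.
set G := F `&` first_hit _ n k in GZ *.
have mHy l := measurable_first_hit l (natural_above y) GZ.
rewrite (split_hit (above y) _ _ (natural_above y) GZ); last by move=> w [_]; exact.
apply: (@le_trans _ _ (\sum_(0 <= l <oo)
    ((x / y) ^+ j)%:E * P (G `&` first_hit (above y) k l))%E).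
  apply: lee_nneseries => // l _; apply: (IH l).
  exact: natural_first_hit (natural_above y) GZ.
rewrite nneseriesZl// exprSr EFinM -muleA; apply: lee_wpmul2l.
  by rewrite lee_fin exprn_ge0.
rewrite -prob_bigcup//; last exact: first_hit_trivIset.
rewrite first_hit_bigcup.
have mG : measurable G := mnat GZ.
(* On [G] the value at time [k] is at most [x], so the maximal inequality bounds by [x / y] the
   conditional chance of reaching [y] from then on. *)
have : (y%:E * P (G `&` [set w | exists2 l, (k <= l)%N & above y l w]) <= x%:E * P G)%E.
  apply: le_trans (martingale_maximal (ltW y0) GZ) _.
  rewrite -integral_cst//; apply: ge0_le_integral => //.
  - by move=> w _; rewrite lee_fin.
  - by move=> w [_ [_ ? _]]; rewrite lee_fin.
set A := P (_ `&` _); have -> : (x / y)%:E = ((y^-1)%:E * x%:E)%E by rewrite -EFinM mulrC.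
rewrite -muleA => H.
have -> : A = ((y^-1)%:E * (y%:E * A))%E by rewrite muleA -EFinM mulVf ?gt_eqF// mul1e.
by apply: lee_wpmul2l => //; rewrite lee_fin invr_ge0 ltW.
Qed.

Let upcross0 x y : 0 <= x -> x < y -> P (upcross x y) = 0%E.
Proof.
move=> x0 xy; have y0 : 0 < y by exact: le_lt_trans xy.
have bnd j : fine (P (upcross x y)) <= (x / y) ^+ j.
  rewrite -lee_fin fineK ?fin_num_measure// -[upcross x y]setTI.
  apply: le_trans (upcross_geometric (n := 0) j x0 xy _) _.
    by apply/in_natural_filtrationP.
  by rewrite probability_setT mule1.
have : fine (P (upcross x y)) <= 0.
  have c1 : `|x / y| < 1.
    by rewrite ger0_norm ?divr_ge0 ?(ltW y0)// ltr_pdivrMr// mul1r.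
  have cz := cvg_geometric 1 c1.
  rewrite -(cvg_lim (@Rhausdorff R) cz); apply: limr_ge; first by apply/cvg_ex; exists 0.
  by apply: nearW => j; rewrite /= mul1r.
move=> h; rewrite -(fineK (fin_num_measure P _ (measurable_upcross x y))).
by congr EFin; apply/eqP; rewrite eq_le h fine_ge0.
Qed.

Let unbounded : set Omega := \bigcap_m [set w | exists2 k, (0 <= k)%N & (m.+1)%:R <= W k w].

Let unbounded0 : P.-negligible unbounded.
Proof.
have mA m : measurable [set w | exists2 k, (0 <= k)%N & (m.+1)%:R <= W k w].
  have -> : [set w | exists2 k, (0 <= k)%N & (m.+1)%:R <= W k w] =
     \bigcup_k above (m.+1)%:R k.
    by apply/seteqP; split => w [k _ ?]; exists k.
  by apply: bigcup_measurable => k _; exact: mnat (natural_above _ k).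
have mU : measurable unbounded by apply: bigcap_measurable => // m _; exact: mA.
apply/negligibleP => //.
set I := (\int[P]_w (W 0%N w)%:E)%E.
have Ifin : I \is a fin_num.
  by case: mart => _ [_ [iW _]]; apply: integrable_fin_num => //; exact: iW.
have bnd m : fine (P unbounded) <= fine I * harmonic m.
  rewrite ler_pdivlMr// mulrC -lee_fin EFinM !fineK ?fin_num_measure//.
  apply: le_trans (@martingale_maximal (m.+1)%:R 0%N setT _ _).
  - apply: lee_wpmul2l; first by rewrite lee_fin.
    by rewrite setTI; apply: le_prob => //; exact: bigcap_inf.
  - by [].
  - by apply/in_natural_filtrationP.
have : fine (P unbounded) <= 0.
  have cz : (fun m => fine I * harmonic m) @ \oo --> fine I * 0.
    by apply: cvgMr; exact: cvg_harmonic.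
  rewrite -(mulr0 (fine I)) -(cvg_lim (@Rhausdorff R) cz); apply: limr_ge.
    by apply/cvg_ex; exists (fine I * 0).
  exact: nearW.
move=> h; rewrite -(fineK (fin_num_measure P _ mU)).
by congr EFin; apply/eqP; rewrite eq_le h fine_ge0.
Qed.

Lemma martingale_cvg : {ae P, forall w, exists l : R, W ^~ w @ \oo --> l}.
Proof.
have Hb : {ae P, forall w, ~ unbounded w}.
  by apply: negligibleS unbounded0 => w /= /contrapT.
pose Q n w := if @choice.unpickle (rat * rat)%type n is Some pq then
  0 <= ratr pq.1 :> R -> ratr pq.1 < ratr pq.2 :> R ->
  ~ upcross (ratr pq.1) (ratr pq.2) w else True.
have Hu : {ae P, forall w, forall n, Q n w}.
  apply: (@ae_foralln _ _ _ P Q) => n; rewrite /Q.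
  case: choice.unpickle => [[p q]|]; last exact: nearW.
  have [p0|p0] := boolP (0 <= ratr p :> R); last by apply: nearW => w; move: p0 => /negP.
  have [pq|pq] := boolP (ratr p < ratr q :> R); last by apply: nearW => w; move: pq => /negP.
  exists (upcross (ratr p) (ratr q)); split => //; first exact: upcross0.
  by move=> w /= /not_implyP[_ /not_implyP[_ /contrapT]].
apply: filterS2 Hb Hu => w Hb Hu.
have [M HM] : exists M, forall k, W k w <= M.
  apply: contrapT => nM; apply: Hb => m _; apply: contrapT => Hm; apply: nM.
  exists (m.+1)%:R => k; rewrite leNgt; apply/negP => /ltW Wk; apply: Hm; by exists k.
apply: (bounded_no_upcrossing_cvg (W0 ^~ w) HM) => p q p0 pq.
by have := Hu (choice.pickle (p, q)); rewrite /Q choice.pickleK /=; apply.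
Qed.

Lemma martingale_limit : exists Winf : Omega -> R,
  [/\ measurable_fun setT Winf, forall w, 0 <= Winf w &
      {ae P, forall w, W ^~ w @ \oo --> Winf w}].
Proof.
pose L w := limn_esup (fun n => (W n w)%:E).
(* The upper limit is measurable on the whole space; [fine] and the maximum with 0 keep it real and
   nonnegative even where [W] does not converge. *)
exists (fun w => Num.max 0 (fine (L w))); split.
- apply: measurable_maxr => //; apply: (measurableT_comp (@fine_measurable R setT measurableT)).
  by apply: measurable_fun_limn_esup => n; exact: mW.
- by move=> w; rewrite le_max lexx.
apply: filterS martingale_cvg => w [l Wl].
have Wl' : (fun n => (W n w)%:E) @ \oo --> l%:E by apply: cvg_EFin => //; exact: nearW.
rewrite /L (cvg_limn_einf_sup Wl').2/= max_r//.
rewrite -(cvg_lim (@Rhausdorff R) Wl); apply: limr_ge; first by apply/cvg_ex; exists l.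
exact: nearW.
Qed.

End martingale_convergence.

(** * Passage to the limit in the tails; the mixture of an atom and an exponential law *)

Section limit_law.
Context {R : realType}.

(** Both bounds are [1 + t <= exp t], at [t = p / r] for the lower and [t = - p / (p + r)] for the
    upper one. As [m] is [x / p] rounded down, [x - p < m p <= x], whence the shift by [p]. *)
Lemma geometric_exp_bounds (p r x : R) (m : nat) : 0 < p -> 0 < r -> 0 <= x ->
  m%:R <= x / p < m.+1%:R ->
  expR (- x / r) <= (r / (p + r)) ^+ m <= expR (- (x - p) / (p + r)).
Proof.
move=> p0 r0 x0; rewrite ler_pdivlMr// ltr_pdivrMr// -natr1 mulrDl mul1r => /andP[mx xm].
have c0 : 0 < p + r by rewrite addr_gt0.
have q0 : 0 < r / (p + r) by rewrite divr_gt0.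
apply/andP; split.
  have h : expR (- (p / r)) <= r / (p + r).
    rewrite expRN -[leRHS]invf_div lef_pV2 ?posrE ?expR_gt0 ?divr_gt0//.
    by rewrite mulrDl divff ?gt_eqF// addrC; exact: expR_ge1Dx.
  apply: (@le_trans _ _ (expR (- (p / r)) ^+ m)).
    rewrite -expRM_natl ler_expR mulrN mulNr lerN2 mulrA ler_pM2r ?invr_gt0//.
  by apply: lerXn2r => //; rewrite nnegrE ?expR_ge0// ltW.
have h : r / (p + r) <= expR (- (p / (p + r))).
  apply: le_trans (expR_ge1Dx _).
  by have -> : 1 - p / (p + r) = r / (p + r) by field; rewrite gt_eqF.
apply: (@le_trans _ _ (expR (- (p / (p + r))) ^+ m)).
  by apply: lerXn2r => //; rewrite nnegrE ?expR_ge0// ltW.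
rewrite -expRM_natl ler_expR mulrN mulNr lerN2 mulrA ler_pM2r ?invr_gt0//.
by rewrite lerBlDr ltW.
Qed.

Lemma exponential_prob_itvcy (rate x : R) : 0 < rate -> 0 <= x ->
  exponential_prob rate `[x, +oo[ = (expR (- rate * x))%:E.
Proof.
move=> rate0 x0.
have cexp : continuous (fun z : R => - expR (- rate * z)).
  move=> z; apply: cvgN; apply: continuous_comp; last exact: continuous_expR.
  by apply: cvgM; [exact: cvg_cst|exact: cvg_id].
rewrite /exponential_prob (@ge0_continuous_FTC2y _ _ (fun z => - expR (- rate * z)) _ 0).
- by rewrite sub0e -EFinN opprK.
- by move=> z _; apply: exponential_pdf_ge0; exact: ltW.
- apply: (@continuous_subspaceW R^o _ _ [set` `[0, +oo[%R]).
    by apply: subset_itvr; rewrite bnd_simp.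
  exact: within_continuous_exponential_pdf.
- rewrite -oppr0; apply: cvgN.
  rewrite (_ : (fun x => expR (- rate * x)) =
               (fun z => expR (- z)) \o (fun z => rate * z)); last first.
    by apply: eq_fun => z; rewrite mulNr.
  apply: (@cvg_comp _ _ _ _ _ _ (pinfty_nbhs R)); last exact: cvgr_expR.
  exact: gt0_cvgMry.
- by move=> z _; exact: ex_derive.
- by apply/cvg_at_right_filter; exact: cexp.
- move=> z; rewrite in_itv/= andbT => xz.
  by apply: derive1_exponential_pdf; rewrite in_itv/= andbT (le_lt_trans x0).
Qed.

Lemma exponential_prob_itvoy (rate x : R) : 0 < rate -> 0 <= x ->
  exponential_prob rate `]x, +oo[ = (expR (- rate * x))%:E.
Proof.
move=> rate0 x0; rewrite -exponential_prob_itvcy// /exponential_prob.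
apply: integral_itv_obnd_cbnd; apply: measurable_funTS.
by apply/measurable_EFinP; exact: measurable_exponential_pdf.
Qed.

(** Open right rays are stable under intersection and generate the Borel sets; those from [-n]
    exhaust the line with finite mass. *)
Lemma eq_measure_rays (m1 m2 : measure (measurableTypeR R) R) :
  (forall x : R, m1 `]x, +oo[%classic = m2 `]x, +oo[%classic) ->
  (forall x : R, (m1 `]x, +oo[%classic < +oo)%E) ->
  forall A, measurable A -> m1 A = m2 A.
Proof.
move=> m12 m1oo A mA.
apply: (@measure_unique _ _ (measurableTypeR R) (@RGenOInfty.G R)
  (fun n => `](- n%:R), +oo[%classic) _ _ _ _ m1 m2 _ _ A mA).
- exact: RGenOInfty.measurableE.
- move=> _ _ [x ->] [y ->]; exists (Num.max x y).
  by apply/seteqP; split => z /=; rewrite !in_itv/= !andbT gt_max; [case=> -> ->|move/andP].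
- by move=> n; eexists.
- apply/seteqP; split => // z _; exists (Num.truncn `|z|).+1 => //=.
  rewrite in_itv/= andbT; have := truncnS_gt `|z|; have := ler_norm (- z).
  by rewrite normrN; lra.
- by move=> _ [x ->].
- by move=> k.
Qed.

Section random_variable.
Context {d} {Omega : measurableType d} (P : probability Omega R).

(** Fatou's inequality for events: up to a null set [E] lies in the increasing union of the sets
    [G n], and [G n] is contained in [F n]. *)
Lemma prob_le_limit (E : set Omega) (F : nat -> set Omega) (l : \bar R) :
  measurable E -> (forall k, measurable (F k)) ->
  {ae P, forall w, E w -> \forall k \near \oo, F k w} ->
  P (F k) @[k --> \oo] --> l -> (P E <= l)%E.
Proof.
move=> mE mF [N [mN PN EN]] Fl.
pose G n := \bigcap_(k in [set k | (n <= k)%N]) F k.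
have mG n : measurable (G n) by apply: bigcap_measurable => // ; exists n => /=.
have mUG : measurable (\bigcup_n G n) by apply: bigcup_measurable.
have EG : E `<=` (\bigcup_n G n) `|` N.
  move=> w Ew; have [[n _ nF]|nF] := pselect (\forall k \near \oo, F k w).
    by left; exists n => // k /= nk; exact: nF.
  by right; apply: EN => /= /(_ Ew).
apply: (@le_trans _ _ (P (\bigcup_n G n))).
  rewrite -(measureU0 mUG mN PN); apply: le_measure => //; rewrite in_setE//.
  exact: measurableU.
have ndG : {homo G : n m / (n <= m)%N >-> (n <= m)%O}.
  by move=> n m nm; apply/subsetPset => w Gw k /= mk; apply: Gw => /=; exact: leq_trans mk.
have cG := nondecreasing_cvg_mu mG mUG ndG (mu := P).
apply: (lee_cvg_to cG Fl); apply: nearW => n /=.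
by apply: le_measure; rewrite ?in_setE//; apply: bigcap_inf => /=.
Qed.

(** Almost surely [x < Vinf] forces [x < V k] eventually, and [Vinf < y] forces [V k <= y]
    eventually. The second fact gives the lower bound [T y] for every [y > x]; right continuity of
    [T] along [x + 1/(n+1)] closes the gap, even if the limit has an atom at [x]. *)
Lemma prob_gt_limit (V : nat -> Omega -> R) (Vinf : Omega -> R) (T : R -> R) (x : R) :
  (forall k, measurable_fun setT (V k)) -> measurable_fun setT Vinf ->
  {ae P, forall w, V ^~ w @ \oo --> Vinf w} ->
  (forall y, x <= y -> P [set w | y < V k w] @[k --> \oo] --> (T y)%:E) ->
  T (x + n.+1%:R^-1) @[n --> \oo] --> T x ->
  P [set w | x < Vinf w] = (T x)%:E.
Proof.
move=> mV mVinf Vcvg PV Tx.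
have mgt (Y : Omega -> R) y : measurable_fun setT Y -> measurable [set w | y < Y w].
  move=> mY; rewrite -[X in measurable X]setTI (_ : [set w | y < Y w] = Y @^-1` `]y, +oo[%classic).
    by apply: mY => //; exact: measurable_itv.
  by apply/seteqP; split => w /=; rewrite in_itv/= andbT.
have mlt (Y : Omega -> R) y : measurable_fun setT Y -> measurable [set w | Y w < y].
  move=> mY; rewrite -[X in measurable X]setTI (_ : [set w | Y w < y] = Y @^-1` `]-oo, y[%classic).
    by apply: mY => //; exact: measurable_itv.
  by apply/seteqP; split => w /=; rewrite in_itv/=.
apply/eqP; rewrite eq_le; apply/andP; split.
  apply: (@prob_le_limit _ (fun k => [set w | x < V k w])).
  - exact: mgt.
  - by move=> k; exact: mgt.
  - apply: filterS Vcvg => w Vw /= xV.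
    exact: (cvgr_gt (Vinf w) Vw).
  - exact: PV.
have low y : x < y -> ((T y)%:E <= P [set w | (x < Vinf w)%R])%E.
  move=> xy.
  have := @prob_le_limit [set w | Vinf w < y] (fun k => ~` [set w | y < V k w]) (1 - (T y)%:E)%E.
  have -> : P [set w | x < Vinf w] = (1 - P (~` [set w | (x < Vinf w)%R]))%E.
    rewrite -[in LHS](setCK [set w | x < Vinf w]) probability_setC//.
    by apply: measurableC; exact: mgt.
  move=> H; rewrite -[leLHS]/((T y)%:E) -(subKr 1 (T y)) EFinB.
  apply: leeB => //; apply: (@le_trans _ _ (P [set w | Vinf w < y])).
    apply: le_measure; rewrite ?in_setE; [by apply: measurableC; exact: mgt|exact: mlt|].
    by move=> w /= /negP; rewrite -leNgt => /le_lt_trans; apply.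
  rewrite EFinB; apply: H.
  - exact: mlt.
  - by move=> k; apply: measurableC; exact: mgt.
  - apply: filterS Vcvg => w Vw /= Vy.
    apply: filterS (cvgr_lt (Vinf w) Vw y Vy) => k /ltW ky /=.
    by apply/negP; rewrite -leNgt.
  - have -> : (fun k => P (~` [set w | y < V k w])) = (fun k => 1 - P [set w | (y < V k w)%R])%E.
      by apply/funext => k; rewrite probability_setC//; exact: mgt.
    apply: cvgeB => //; first exact: cvg_cst.
    exact: PV (ltW xy).
rewrite -(fineK (fin_num_measure P _ (mgt _ x mVinf))) lee_fin.
rewrite -(cvg_lim (@Rhausdorff R) Tx); apply: limr_le; first by apply/cvg_ex; exists (T x).
apply: nearW => n; rewrite -lee_fin fineK; last by apply: fin_num_measure; exact: mgt.
by apply: low; rewrite ltrDl invr_gt0.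
Qed.

(** Nonnegativity and the tails on [x >= 0] fix the mass of every ray: for negative [x] both sides
    are one, and for [x >= 0] the atom at 0 does not count. *)
Lemma exponential_mixture_law (X : {RV P >-> R}) (r : R) : 0 < r -> (forall w, 0 <= X w) ->
  (forall x, 0 <= x -> P [set w | x < X w] = (expR (- x / r) / r)%:E) ->
  (forall V : set R, measurable V ->
     P (X @^-1` V) = ((1 - r^-1)%:E * \d_(0%R : R) V + r^-1%:E * exponential_prob r^-1 V)%E) /\
  ('E_P[X] = 1)%E.
Proof.
move=> r0 X0 PX.
have ri0 : 0 < r^-1 by rewrite invr_gt0.
have rayE (x : R) : X @^-1` `]x, +oo[%classic = [set w | x < X w].
  by apply/seteqP; split => w /=; rewrite in_itv/= andbT.
have [E EE] : exists m : probability (measurableTypeR R) R,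
    m = exponential_prob r^-1 :> (set R -> \bar R).
  by unshelve eexists (exponential_prob r^-1).
split.
  (* The tail at 0 is [1 / r]; being a probability, it leaves a nonnegative weight for the atom. *)
  have r1 : r^-1 <= 1.
    rewrite -lee_fin; have := PX 0 (lexx 0); rewrite oppr0 mul0r expR0 mul1r => <-.
    by apply: probability_le1; rewrite -rayE -[X in measurable X]setTI; exact: measurable_funP.
  have r1' : 0 <= 1 - r^-1 by rewrite subr_ge0.
  pose m2 : measure (measurableTypeR R) R := measure_add
    (mscale (NngNum r1') (\d_(0 : measurableTypeR R)))
    (mscale (NngNum (ltW ri0)) E).
  have m2E V : m2 V = ((1 - r^-1)%:E * \d_(0%R : R) V + r^-1%:E * exponential_prob r^-1 V)%E.
    by rewrite -EE; exact: measure_addE.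
  have [m1 m1E] : exists m1 : measure (measurableTypeR R) R,
      forall V, m1 V = P (X @^-1` V).
    have mX : @measurable_fun _ _ Omega (measurableTypeR R) setT X.
      by move=> mT Y mY; exact: (@measurable_funP _ _ _ _ setT X mT Y mY).
    by unshelve eexists (pushforward P (X : Omega -> measurableTypeR R)).
  move=> V mV; rewrite -m2E -m1E.
  apply: (@eq_measure_rays m1 m2 _ _ V mV) => x; last first.
    rewrite m1E ltey_eq fin_num_measure// -[X in measurable X]setTI.
    by apply: measurable_funP => //; exact: measurable_itv.
  rewrite m2E m1E rayE diracE.
  have [x0|x0] := leP 0 x.
    rewrite PX// exponential_prob_itvoy// memNset/= ?mule0 ?add0e; last first.
      by rewrite in_itv/= andbT; apply/negP; rewrite -leNgt.
    by rewrite -EFinM mulrC; congr (_ * expR _)%:E; ring.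
  rewrite mem_set/=; last by rewrite in_itv/= andbT.
  have -> : [set w | x < X w] = setT.
    by apply/seteqP; split => w //= _; exact: lt_le_trans (X0 w).
  have -> : exponential_prob r^-1 `]x, +oo[ = 1%E.
    apply/eqP; rewrite eq_le -EE probability_le1/=; last exact: measurable_itv.
    have := exponential_prob_itvoy ri0 (lexx 0); rewrite mulr0 expR0 -EE => <-.
    apply: le_measure; rewrite ?in_setE; try exact: measurable_itv.
    by apply: subset_itvr; rewrite bnd_simp ltW.
  by rewrite probability_setT !mule1 -EFinD subrK.
rewrite ge0_expectation_ccdf//.
have <- : exponential_prob r^-1 `[0, +oo[ = 1%E.
  by rewrite exponential_prob_itvcy// mulr0 expR0.
apply: eq_integral => x /set_mem/=; rewrite in_itv/= andbT => x0.
rewrite -[LHS]/(P (X @^-1` `]x, +oo[%classic)) rayE PX// exponential_pdfE//.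
by rewrite mulrC; congr (_ * expR _)%:E; ring.
Qed.

End random_variable.
End limit_law.

(** * Tails and limit of [W] in one fixed supercritical environment *)

Section environment.
Context {R : realType} (a b : nat -> R).
Hypotheses (a0 : forall n, 0 < a n) (b0 : forall n, 0 < b n).

Lemma Pi_gt0 n : 0 < Pi a n.
Proof. by rewrite /Pi; apply: prodr_gt0 => i _. Qed.

Hypothesis Rfin : (R_infty a b < +oo)%E.

Lemma R_inftyE : R_infty a b = (fine (R_infty a b))%:E.
Proof.
rewrite fineK// ge0_fin_numE// /R_infty; apply: nneseries_ge0 => k _ _.
by rewrite lee_fin mulr_ge0 ?ltW// Pi_gt0.
Qed.

Lemma cvg_Rsum : Rsum a b n @[n --> \oo] --> fine (R_infty a b).
Proof.
have -> : Rsum a b = series (fun k => Pi a k * b k).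
  by apply/funext => n; rewrite /Rsum /series/= big_mkord.
by apply/nneseries_EFinP; [move=> k; rewrite mulr_ge0 ?ltW ?Pi_gt0|exact: R_inftyE].
Qed.

Lemma Rsum_gt0 n : 0 < Rsum a b n.+1.
Proof.
rewrite /Rsum big_ord_recr/= ltr_wpDl ?mulr_gt0 ?Pi_gt0//.
by apply: sumr_ge0 => i _; rewrite mulr_ge0 ?ltW ?Pi_gt0.
Qed.

Lemma R_infty_gt0 : 0 < fine (R_infty a b).
Proof.
apply: (lt_le_trans (Rsum_gt0 0)); rewrite -(cvg_lim (@Rhausdorff R) cvg_Rsum).
apply: limr_ge; first by apply/cvg_ex; eexists; exact: cvg_Rsum.
exists 1%N => // n /= n1; rewrite /Rsum -(subnKC n1) big_split_ord/= lerDl.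
by apply: sumr_ge0 => i _; rewrite mulr_ge0 ?ltW ?Pi_gt0.
Qed.

Hypothesis Rinv : R_infty_inv a b = +oo%E.

(* Were Pi bounded below by delta, the series for R_infty would dominate
   delta^2 times the divergent series for R_infty_inv. *)
Let Pi_not_bounded_below (delta : R) : 0 < delta -> exists n, Pi a n < delta.
Proof.
move=> delta0; apply: contrapT => H.
have Pid n : delta <= Pi a n by rewrite leNgt; apply/negP => ?; apply: H; exists n.
suff : (R_infty_inv a b < +oo)%E by rewrite Rinv ltxx.
apply: (@le_lt_trans _ _ ((delta ^- 2)%:E * R_infty a b)%E); last first.
  by rewrite R_inftyE -EFinM ltry.
rewrite /R_infty -nneseriesZl; last by move=> k _; rewrite lee_fin mulr_ge0 ?ltW ?Pi_gt0.
apply: lee_nneseries => k _.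
  by move=> _; rewrite lee_fin mulr_ge0 ?invr_ge0 ?ltW ?Pi_gt0.
rewrite -EFinM lee_fin mulrA ler_pM2r//.
apply: (@le_trans _ _ delta^-1); first by rewrite lef_pV2 ?posrE ?Pi_gt0.
have dP : 1 <= delta^-1 * Pi a k by rewrite mulrC ler_pdivlMr// mul1r.
by rewrite -exprVn expr2 -mulrA ler_peMr// invr_ge0 ltW.
Qed.

(** No [Pi_n] vanishes, so values below any threshold recur arbitrarily late. *)
Lemma Pi_subsequence : exists phi : nat -> nat,
  (forall k, (k < phi k)%N) /\ Pi a (phi k) @[k --> \oo] --> 0.
Proof.
have late N (e : R) : 0 < e -> exists n, (N < n)%N /\ Pi a n < e.
  elim: N e => [|N IH] e e0.
    (* The minimum with [1 = Pi_0] excludes [n = 0]. *)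
    have [n Pn] := Pi_not_bounded_below (delta := Num.min e 1) (ltac:(by rewrite lt_min e0 ltr01)).
    exists n; split; last by move: Pn; rewrite lt_min => /andP[].
    by case: n Pn => //; rewrite /Pi big_ord0 lt_min ltxx andbF.
  (* A value below [Pi_(N.+1)] cannot sit at index [N.+1], which pushes the index one step
     further. *)
  have e10 : 0 < Num.min e (Pi a N.+1) by rewrite lt_min e0 Pi_gt0.
  have [n [Nn]] := IH _ e10; rewrite lt_min => /andP[Pe PN].
  exists n; split => //; rewrite ltn_neqAle Nn andbT.
  by apply: contraTneq PN => <-; rewrite ltxx.
have /choice[phi Hphi] k : exists n, (k < n)%N /\ Pi a n < (k.+1%:R : R)^-1.
  by apply: late; rewrite invr_gt0.
exists phi; split; first by move=> k; case: (Hphi k).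
apply: (@squeeze_cvgr _ _ _ _ (fun=> 0) (@harmonic R)).
- by apply: nearW => k; rewrite ltW ?Pi_gt0//= ltW//; case: (Hphi k).
- exact: cvg_cst.
- exact: cvg_harmonic.
Qed.

Context {d} {Omega : measurableType d} (P : probability Omega R).
Context (xi : nat -> nat -> Omega -> nat) (Z : nat -> Omega -> nat).
Hypothesis gw : LF_GW_process P a b xi Z.
Let r := fine (R_infty a b).
Let W n w := Pi a n * (Z n w)%:R.

Let mZ n k : measurable (Z n @^-1` [set k]).
Proof. exact: gw_measurable gw n k. Qed.

Let mW n : measurable_fun setT (W n).
Proof.
by apply/measurable_EFinP; exact: (measurable_fun_natR (fun k => Pi a n * k%:R) (mZ n)).
Qed.

Lemma gw_mean n : (\int[P]_w ((Z n w)%:R)%:E = ((Pi a n)^-1)%:E)%E.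
Proof.
apply: (@lf_mean _ _ _ _ (Pi a n) (Rsum a b n)) => //; last exact: gw_pgf gw n.
  exact: Pi_gt0.
by apply: sumr_ge0 => i _; rewrite mulr_ge0 ?ltW ?Pi_gt0.
Qed.

Let integralW n F : measurable F ->
  (\int[P]_(w in F) (W n w)%:E = (Pi a n)%:E * \int[P]_(w in F) ((Z n w)%:R)%:E)%E.
Proof.
move=> mF; rewrite -ge0_integralZl_EFin//.
- exact: (@measurable_fun_natR _ _ _ (Z n) (fun k => k%:R)).
- by rewrite ltW ?Pi_gt0.
Qed.

Let mean_W n : (\int[P]_w (W n w)%:E = 1)%E.
Proof. by rewrite integralW// gw_mean -EFinM divff// gt_eqF ?Pi_gt0. Qed.

Lemma gw_expectation n : ('E_P[W n] = 1)%E.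
Proof. by rewrite unlock; exact: mean_W. Qed.

Let W_ge0 n w : 0 <= W n w.
Proof. by rewrite mulr_ge0// ltW// Pi_gt0. Qed.

(** The mean offspring number [1 / a n] cancels the new factor in [Pi_(n.+1) = Pi_n a_n];
    integrability comes from nonnegativity and mean one. *)
Lemma gw_martingale : martingale P Z W.
Proof.
split; first exact: mW.
split.
  move=> n S _; apply/in_natural_filtrationP => w w' ww'.
  by rewrite /preimage/= /W ww'.
split.
  move=> n; apply/integrableP; split; first exact/measurable_EFinP.
  rewrite (eq_integral (fun w => (W n w)%:E)) ?mean_W ?ltry// => w _.
  by rewrite /= ger0_norm.
move=> n F FZ; have [mF _] := gw_natural_indep gw FZ.
rewrite !integralW// (gw_integral_step a0 b0 gw FZ).
have mZn : measurable_fun F (fun w => ((Z n w)%:R : R)%:E).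
  exact: (@measurable_fun_natR _ _ _ (Z n) (fun k => k%:R)).
rewrite (eq_integral (fun w => ((a n)^-1)%:E * ((Z n w)%:R)%:E)%E); last first.
  by move=> w _; rewrite -EFinM mulrC.
rewrite ge0_integralZl_EFin// ?invr_ge0 ?ltW// muleA -EFinM; congr (_%:E * _)%E.
by rewrite /Pi big_ord_recr/= mulfK// gt_eqF.
Qed.

(** As [Z n] is an integer, [W n > x] means [Z n > m] with [m] the integer part of [x / Pi_n], and
    the exact tail applies. For [n = 0] the sum [R_n] is empty; [n > 0] keeps this divisor
    positive. *)
Let tail_bounds n x : (0 < n)%N -> 0 <= x ->
  expR (- x / Rsum a b n) / (Pi a n + Rsum a b n) <= fine (P [set w | x < W n w]) <=
  expR (- (x - Pi a n) / (Pi a n + Rsum a b n)) / (Pi a n + Rsum a b n).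
Proof.
case: n => // n _ x0; have Pn := Pi_gt0 n.+1; have Rn := Rsum_gt0 n.
have c0 : 0 < Pi a n.+1 + Rsum a b n.+1 by rewrite addr_gt0.
have xP : 0 <= x / Pi a n.+1 by rewrite divr_ge0// ltW.
set m := Num.truncn (x / Pi a n.+1).
have -> : [set w | x < W n.+1 w] = [set w | (m < Z n.+1 w)%N].
  apply/seteqP; split => w /=; rewrite /m truncn_lt_nat// ltr_pdivrMr// mulrC//.
rewrite (lf_tail Pn (ltW Rn) (mZ n.+1) (gw_pgf a0 b0 gw n.+1))/=.
rewrite !ler_pM2r ?invr_gt0//; apply: geometric_exp_bounds => //.
by rewrite truncn_le xP /m truncnS_gt.
Qed.

Let tail_limit phi x : (forall k, (k < phi k)%N) -> Pi a (phi k) @[k --> \oo] --> 0 -> 0 <= x ->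
  P [set w | x < W (phi k) w] @[k --> \oo] --> (expR (- x / r) / r)%:E.
Proof.
move=> phik Pphi x0.
have r0 : r != 0 by rewrite gt_eqF// R_infty_gt0.
have phioo : phi k @[k --> \oo] --> \oo.
  move=> A [N _ NA]; exists N => // k /= Nk; apply: NA => /=.
  exact: leq_trans Nk (ltnW (phik k)).
have Rphi : Rsum a b (phi k) @[k --> \oo] --> r.
  exact: (cvg_comp phi (Rsum a b) phioo cvg_Rsum).
have cphi : Pi a (phi k) + Rsum a b (phi k) @[k --> \oo] --> r.
  by rewrite -[X in _ --> X]add0r; apply: cvgD.
have cinv : (Pi a (phi k) + Rsum a b (phi k))^-1 @[k --> \oo] --> r^-1 by apply: cvgV.
have mgt k : measurable [set w | x < W (phi k) w].
  rewrite -[X in measurable X]setTI.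
  rewrite (_ : [set w | x < W (phi k) w] = W (phi k) @^-1` `]x, +oo[%classic).
    by apply: mW => //; exact: measurable_itv.
  by apply/seteqP; split => w /=; rewrite in_itv/= andbT.
have -> : (fun k => P [set w | x < W (phi k) w]) =
    (fun k => (fine (P [set w | (x < W (phi k) w)%R]))%:E).
  by apply/funext => k; rewrite fineK// fin_num_measure.
apply: cvg_EFin; first exact: nearW.
apply: (@squeeze_cvgr _ _ _ _
  (fun k => expR (- x / Rsum a b (phi k)) / (Pi a (phi k) + Rsum a b (phi k)))
  (fun k => expR (- (x - Pi a (phi k)) / (Pi a (phi k) + Rsum a b (phi k))) /
            (Pi a (phi k) + Rsum a b (phi k)))).
- by apply: nearW => k; apply: tail_bounds => //; exact: leq_ltn_trans (phik k).
- apply: cvgM => //; apply: continuous_cvg; first exact: continuous_expR.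
  by apply: cvgM; [exact: cvg_cst|exact: cvgV].
- apply: cvgM => //; apply: continuous_cvg; first exact: continuous_expR.
  apply: cvgM => //; apply: cvgN; rewrite -[X in _ --> X](subr0 x).
  by apply: cvgB => //; exact: cvg_cst.
Qed.

Lemma gw_limit : exists Winf : Omega -> R,
  [/\ measurable_fun setT Winf,
      {ae P, forall w, W ^~ w @ \oo --> Winf w},
      (forall V : set R, measurable V ->
         P (Winf @^-1` V) =
         ((1 - r^-1)%:E * \d_(0%R : R) V + r^-1%:E * exponential_prob r^-1 V)%E) &
      ('E_P[Winf] = 1)%E].
Proof.
have [Winf [mWinf Winf0 Wcvg]] := martingale_limit gw_martingale W_ge0
  (fun n F FZ => proj1 (gw_natural_indep gw FZ)).
have [phi [phik Pphi]] := Pi_subsequence.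
have r0 := R_infty_gt0.
have PWinf x : 0 <= x -> P [set w | x < Winf w] = (expR (- x / r) / r)%:E.
  move=> x0; apply: (@prob_gt_limit _ _ _ P (fun k => W (phi k)) Winf
    (fun x => expR (- x / r) / r)) => //.
  - apply: filterS Wcvg => w Ww.
    apply: cvg_comp Ww => A [N _ NA]; exists N => // k /= Nk; apply: NA => /=.
    exact: leq_trans Nk (ltnW (phik k)).
  - by move=> y xy; apply: tail_limit => //; exact: le_trans xy.
  - apply: cvgM; last exact: cvg_cst.
    apply: continuous_cvg; first exact: continuous_expR.
    apply: cvgM; last exact: cvg_cst.
    apply: cvgN; rewrite -[X in _ --> X](addr0 x).
    by apply: cvgD; [exact: cvg_cst|exact: cvg_harmonic].
have [law mean] := exponential_mixture_law (X := mfun_Sub (mem_set mWinf)) r0 Winf0 PWinf.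
by exists Winf; split.
Qed.

End environment.

(** * From a fixed environment to almost every environment *)

Lemma iid_ae {R : realType} {d d'} {Omega : measurableType d} {T : measurableType d'}
    (P : probability Omega R) (X : nat -> Omega -> T) (V : set T) :
  iid P X -> measurable V -> P (X 0%N @^-1` V) = 1%E -> {ae P, forall w n, V (X n w)}.
Proof.
move=> [mX _ idX] mV PV; apply: ae_foralln => n.
have mXV : measurable (X n @^-1` V) by rewrite -[X in measurable X]setTI; exact: mX.
exists (~` (X n @^-1` V)); split; [exact: measurableC| |by []].
by rewrite [LHS](@probability_setC _ _ _ P)// idX// PV subee.
Qed.

Theorem theorem4p2 (R : realType) (de : measure_display)
  (Omega_e : measurableType de) (Pe : probability Omega_e R)
  (A B : nat -> Omega_e -> R) :
  (* (A_n, B_n)_{n>=1} (indexed from 0 here) are i.i.d. copies of (A,B) *)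
  iid Pe (fun n w => (A n w, B n w)) ->
  (* P(A > 0, B > 0, A + B >= 1) = 1 *)
  Pe [set w | 0 < A 0%N w /\ 0 < B 0%N w /\ 1 <= A 0%N w + B 0%N w] = 1%E ->
  (* supercriticality: R_infty < oo = R^(-1)_infty a.s. *)
  {ae Pe, forall we, (R_infty (A ^~ we) (B ^~ we) < +oo)%E /\
                     R_infty_inv (A ^~ we) (B ^~ we) = +oo%E} ->
  (* for almost every realisation of the environment ... *)
  {ae Pe, forall we,
    let a := A ^~ we in let b := B ^~ we in
    let r := fine (R_infty a b) in
    (* ... and any realisation of the process under P = P(. | e) ... *)
    forall (d : measure_display) (Omega : measurableType d)
      (P : probability Omega R) (xi : nat -> nat -> Omega -> nat)
      (Z : nat -> Omega -> nat),
    LF_GW_process P a b xi Z ->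
    let W := fun n w => Pi a n * (Z n w)%:R in
    [/\ (forall n w, 0 <= W n w),
        martingale P Z W,
        (forall n, ('E_P[W n] = 1)%E) &
        exists Winf : Omega -> R,
          [/\ measurable_fun setT Winf,
              {ae P, forall w, W ^~ w @ \oo --> Winf w},
              (forall V : set R, measurable V ->
                 P (Winf @^-1` V) =
                 ((1 - r^-1)%:E * \d_(0%R : R) V + r^-1%:E * exponential_prob r^-1 V)%E) &
              ('E_P[Winf] = 1)%E]]}.
Proof.
move=> iidAB PAB super.
pose V : set (R * R) := [set ab | 0 < ab.1 /\ 0 < ab.2 /\ 1 <= ab.1 + ab.2].
have mV : measurable V.
  have -> : V = ((fst : R * R -> R) @^-1` `]0, +oo[%classic) `&`
      ((snd : R * R -> R) @^-1` `]0, +oo[%classic `&`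
       (fun ab : R * R => ab.1 + ab.2) @^-1` `[1, +oo[%classic).
    by apply/seteqP; split => -[x y]; rewrite /V/= !in_itv/= !andbT.
  apply: measurableI; last apply: measurableI; rewrite -[X in measurable X]setTI.
  - by apply: measurable_fst => //; exact: measurable_itv.
  - by apply: measurable_snd => //; exact: measurable_itv.
  - have : measurable_fun setT (fun ab : R * R => ab.1 + ab.2) by exact: measurable_funD.
    by apply => //; exact: measurable_itv.
(* Almost every environment is positive in all generations at once and satisfies both series
   conditions; from here on it is a fixed pair of sequences. *)
apply: filterS2 (iid_ae iidAB mV PAB) super => we pos [Rfin Rinv] d Omega P xi Z gw.
have a0 n : 0 < A n we by have [] := pos n.
have b0 n : 0 < B n we by have [_ []] := pos n.
split.
- by move=> n w; rewrite mulr_ge0// ltW// Pi_gt0.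
- exact: gw_martingale gw.
- by move=> n; exact: (gw_expectation a0 b0 gw n).
- exact: (gw_limit a0 b0 Rfin Rinv gw).
Qed.
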